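(* Let $\mathcal{A}$ be an $n$-dimensional perfect evolution algebra over a field $\mathbb{K}$. The identity component of the affine group scheme $\mathbf{Taut}(\mathcal{A})$ of ternary automorphisms of $\mathcal{A}$ is isomorphic to the torus $\mathbf{G}_{\mathbf m}^{2n}$. Moreover, $\mathbf{Taut}(\mathcal{A})\cong \mathbf{G}_{\mathbf m}^{2n}\times \underline{S_n}$.
   Context: $\mathbb{K}$ is an arbitrary field and $n\ge 1$. An algebra is a $\mathbb{K}$-vector space with a bilinear product (not assumed associative or unital). An $n$-dimensional evolution algebra is an $n$-dimensional algebra $\mathcal{A}$ admitting a basis $\{e_1,\dots,e_n\}$ (a natural basis) such that $e_ie_j=0$ for all $i\ne j$; write $e_i^2=\sum_{k=1}^n w_{ki}e_k$. $\mathcal{A}$ is perfect if $\mathcal{A}^2=\mathcal{A}$, equivalently the matrix $(w_{ki})$ is invertible. For a commutative unital associative $\mathbb{K}$-algebra $R$, let $\mathcal{A}_R=\mathcal{A}\otimes_{\mathbb{K}}R$ be the scalar extension. A ternary automorphism of $\mathcal{A}_R$ is a triple $(f_1,f_2,f_3)$ of bijective $R$-linear maps $\mathcal{A}_R\to\mathcal{A}_R$ with $f_1(xy)=f_2(x)f_3(y)$ for all $x,y\in\mathcal{A}_R$; these form a group $\mathrm{Taut}(\mathcal{A}_R)$ under componentwise composition. The group scheme $\mathbf{Taut}(\mathcal{A})$ is the functor $R\mapsto \mathrm{Taut}(\mathcal{A}_R)$ from commutative unital associative $\mathbb{K}$-algebras to groups. $\mathbf{G}_{\mathbf m}$ is the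 multiplicative group scheme (the affine $\mathbb{K}$-group scheme represented by the Hopf algebra of Laurent polynomials $\mathbb{K}[x^{\pm}]$), and $\mathbf{G}_{\mathbf m}^{k}$ is called the $k$-dimensional torus. $S_n$ is the group of permutations of $n$ elements, and $\underline{S_n}$ is the constant $\mathbb{K}$-group scheme associated with $S_n$ (represented by $\mathbb{K}^{n!}$ with its corresponding Hopf algebra structure).
   Formalization: The direct product formula is false as an isomorphism of group schemes for n≥2 (take A=K×K); it is proved as an isomorphism of K-schemes, and as group schemes Taut(A) is shown isomorphic to a semidirect product of G_m^{2n} by the constant group scheme S_n for some action. *)

(* Defs.v *)
From HB Require Import structures.
From mathcomp Require Import all_boot all_order all_fingroup all_algebra sesquilinear.
From mathcomp Require Import boolp classical_sets topology.

Set Implicit Arguments.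
Unset Strict Implicit.
Unset Printing Implicit Defensive.

Import GRing.Theory.

Local Open Scope classical_set_scope.
Local Open Scope ring_scope.

#[local] Obligation Tactic := idtac.

(* Commutative unital associative K-algebras. MathComp's comAlgType K excludes
   the zero ring, which does belong to the category on which affine group
   schemes are defined; hence a possibly zero ring with a structure map. *)
Record comAlg (K : fieldType) := ComAlg {
  comAlg_ring :> comPzRingType;
  comAlg_str : {rmorphism K -> comAlg_ring}
}.

Arguments comAlg_str {K} R : rename.

Record algHom (K : fieldType) (R S : comAlg K) := AlgHom {
  algHom_fun :> R -> S;
  algHomB : zmod_morphism algHom_fun;
  algHomM : monoid_morphism algHom_fun;
  algHomA : forall a : K, algHom_fun (comAlg_str R a) = comAlg_str S a
}.

HB.instance Definition _ K R S (f : @algHom K R S) :=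
  GRing.isZmodMorphism.Build R S f (algHomB f).
HB.instance Definition _ K R S (f : @algHom K R S) :=
  GRing.isMonoidMorphism.Build R S f (algHomM f).

Lemma algHom_ext (K : fieldType) (R S : comAlg K) (f g : algHom R S) :
  f =1 g -> f = g.
Proof.
case: f g => [f a b c] [g a' b' c'] /= /funext fg.
by case: _ / fg in a' b' c' *; congr AlgHom; exact: Prop_irrelevance.
Qed.

HB.instance Definition _ K R S := gen_eqMixin (@algHom K R S).
HB.instance Definition _ K R S := gen_choiceMixin (@algHom K R S).

Program Definition algHom_id (K : fieldType) (R : comAlg K) : algHom R R :=
  @AlgHom K R R idfun _ _ _.
Next Obligation. by []. Qed.
Next Obligation. by []. Qed.
Next Obligation. by []. Qed.

Program Definition algHom_comp (K : fieldType) (R S T : comAlg K)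
    (g : algHom S T) (f : algHom R S) : algHom R T :=
  @AlgHom K R T (g \o f) _ _ _.
Next Obligation. by move=> K R S T g f x y /=; rewrite !rmorphB. Qed.
Next Obligation.
by move=> K R S T g f; split=> [|x y] /=; rewrite ?rmorph1 ?rmorphM.
Qed.
Next Obligation. by move=> K R S T g f a /=; rewrite !algHomA. Qed.

Definition base_alg (K : fieldType) : comAlg K := @ComAlg K K idfun.

(* Functors from commutative K-algebras to groups. *)
Record grpFunctor (K : fieldType) := GrpFunctor {
  points :> comAlg K -> groupType;
  fmap : forall R S : comAlg K, algHom R S -> points R -> points S;
  fmapM : forall (R S : comAlg K) (f : algHom R S),
    {morph fmap f : x y / (x * y)%g};
  fmap_id : forall (R : comAlg K) (x : points R), fmap (algHom_id R) x = x;
  fmap_comp : forall (R S T : comAlg K) (g : algHom S T) (f : algHom R S)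
    (x : points R), fmap (algHom_comp g f) x = fmap g (fmap f x)
}.

Arguments fmap {K} G {R S} f x : rename.

Definition natural (K : fieldType) (G H : grpFunctor K)
    (alpha : forall R, G R -> H R) : Prop :=
  forall (R S : comAlg K) (f : algHom R S) (x : G R),
    alpha S (fmap G f x) = fmap H f (alpha R x).

Definition group_hom (K : fieldType) (G H : grpFunctor K)
    (alpha : forall R, G R -> H R) : Prop :=
  natural alpha /\ forall R, {morph alpha R : x y / (x * y)%g}.

(* Isomorphism of the underlying K-schemes, forgetting the group laws; this is
   how a semidirect product is isomorphic to the direct one. *)
Definition scheme_isomorphic (K : fieldType) (G H : grpFunctor K) : Prop :=
  exists alpha : forall R, G R -> H R,
    natural alpha /\ forall R, bijective (alpha R).

Definition group_isomorphic (K : fieldType) (G H : grpFunctor K) : Prop :=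
  exists alpha : forall R, G R -> H R,
    group_hom alpha /\ forall R, bijective (alpha R).

(* By Yoneda, a representing algebra together with its universal point is the
   same as an isomorphism of functors Hom_K(coord_alg, -) -> G. *)
Record representation (K : fieldType) (G : grpFunctor K) := Representation {
  coord_alg : comAlg K;
  univ_point : G coord_alg;
  univ_pointP : forall (R : comAlg K) (g : G R),
    exists! phi : algHom coord_alg R, fmap G phi univ_point = g
}.

Definition affine (K : fieldType) (G : grpFunctor K) : Prop :=
  exists rep : representation G, True.

Definition classify (K : fieldType) (G : grpFunctor K)
    (rep : representation G) (R : comAlg K) (g : G R) :
    algHom (coord_alg rep) R :=
  projT1 (cid (univ_pointP rep g)).

Definition counit (K : fieldType) (G : grpFunctor K)
    (rep : representation G) : algHom (coord_alg rep) (base_alg K) :=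
  classify rep (1%g : G (base_alg K)).

Record prime_ideal (R : comPzRingType) (P : set R) : Prop := PrimeIdeal {
  prime_ideal0 : P 0;
  prime_idealD : forall x y, P x -> P y -> P (x + y);
  prime_idealMl : forall a x, P x -> P (a * x);
  prime_ideal1 : ~ P 1;
  prime_idealM : forall x y, P (x * y) -> P x \/ P y
}.

Record spec (R : comPzRingType) := Spec {
  spec_set : set R;
  specP : prime_ideal spec_set
}.

HB.instance Definition _ R := gen_eqMixin (spec R).
HB.instance Definition _ R := gen_choiceMixin (spec R).

Definition zariski_open (R : comPzRingType) : set_system (spec R) :=
  [set U | exists E : set R, U = [set p : spec R | exists2 f, E f & ~ spec_set p f]].

Section Zariski.
Variable R : comPzRingType.

Lemma zariski_openT : zariski_open [set: spec R].
Proof.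
exists [set 1]; apply/seteqP; split=> // p _; exists 1 => //.
exact: prime_ideal1 (specP p).
Qed.

Lemma zariski_openI : setI_closed (@zariski_open R).
Proof.
move=> _ _ [E ->] [F ->].
exists [set h | exists f g, [/\ E f, F g & h = f * g]].
apply/seteqP; split=> p /=.
  move=> [[f Ef pf] [g Fg pg]]; exists (f * g); first by exists f, g.
  by move/(prime_idealM (specP p)) => -[].
move=> [_ [f [g [Ef Fg ->]]] pfg]; split.
  by exists f => // pf; apply: pfg; rewrite mulrC; exact: prime_idealMl (specP p) _ _ pf.
by exists g => // pg; apply: pfg; exact: prime_idealMl (specP p) _ _ pg.
Qed.

Lemma zariski_open_bigU (I : Type) (f : I -> set (spec R)) :
  (forall i, zariski_open (f i)) -> zariski_open (\bigcup_i f i).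
Proof.
move=> /choice[E fE]; exists (\bigcup_i E i); apply/seteqP; split=> p /=.
  by move=> [i _]; rewrite fE => -[g Eg pg]; exists g => //; exists i.
by move=> [g [i _ Eg] pg]; exists i => //; rewrite fE; exists g.
Qed.

HB.instance Definition _ := isOpenTopological.Build (spec R)
  zariski_openT zariski_openI zariski_open_bigU.

End Zariski.

Lemma prime_preimage (R S : comPzRingType) (f : {rmorphism R -> S})
  (q : spec S) : prime_ideal (f @^-1` spec_set q).
Proof.
case: q => q [q0 qD qM q1 qP] /=; split=> /=.
- by rewrite rmorph0.
- by move=> x y qx qy; rewrite rmorphD; exact: qD.
- by move=> a x qx; rewrite rmorphM; exact: qM.
- by rewrite rmorph1.
- by move=> x y; rewrite rmorphM => /qP.
Qed.

Definition spec_map (R S : comPzRingType) (f : {rmorphism R -> S})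
  (q : spec S) : spec R := Spec (prime_preimage f q).

Lemma prime_zero (K : fieldType) : prime_ideal [set 0 : K].
Proof.
split=> //=.
- by move=> x y -> ->; rewrite addr0.
- by move=> a x ->; rewrite mulr0.
- by move/eqP; rewrite oner_eq0.
- by move=> x y /eqP; rewrite mulf_eq0 => /orP[] /eqP; [left|right].
Qed.

Definition spec_zero (K : fieldType) : spec K := Spec (prime_zero K).

(* The image of Spec K under the unit section, i.e. the point ker(counit). *)
Definition identity_point (K : fieldType) (G : grpFunctor K)
    (rep : representation G) : spec (coord_alg rep) :=
  spec_map (counit rep) (spec_zero K).

Definition identity_component_set (K : fieldType) (G : grpFunctor K)
    (rep : representation G) : set (spec (coord_alg rep)) :=
  connected_component [set: spec (coord_alg rep)] (identity_point rep).

Arguments identity_component_set {K G} rep.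

(* R-points of the identity component: those g : Spec R -> G whose image lies
   in the connected component of the identity. These are the points of the open
   subscheme supported there: the component of the identity of an algebraic
   group scheme is open. *)
Definition in_identity_component (K : fieldType) (G : grpFunctor K)
    (rep : representation G) (R : comAlg K) (g : G R) : Prop :=
  forall q : spec R,
    identity_component_set rep (spec_map (classify rep g) q).

(* T is isomorphic, as a group scheme, to the identity component of G: there is
   a monomorphism of group functors from T to G whose image is the identity
   component. *)
Definition identity_component_isomorphic (K : fieldType) (G : grpFunctor K)
    (rep : representation G) (T : grpFunctor K) : Prop :=
  exists alpha : forall R, T R -> G R,
    [/\ group_hom alpha, forall R, injective (alpha R) &
        forall R (g : G R),
          in_identity_component rep g <-> exists t, alpha R t = g].

(* The points of G_m, as pairs of mutually inverse elements. *)
Record ringUnit (R : comPzRingType) := RingUnit {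
  unit_val : R;
  unit_inv : R;
  unit_valK : unit_val * unit_inv = 1
}.

Lemma ringUnit_ext (R : comPzRingType) (u v : ringUnit R) :
  unit_val u = unit_val v -> u = v.
Proof.
case: u v => [u u' uu'] [v v' vv'] /= uv; case: _ / uv in vv' *.
have e : u' = v' by rewrite -[u']mul1r -vv' mulrC mulrCA mulrA uu' mul1r.
by case: _ / e in vv' *; congr RingUnit; exact: Prop_irrelevance.
Qed.

HB.instance Definition _ R := gen_eqMixin (ringUnit R).
HB.instance Definition _ R := gen_choiceMixin (ringUnit R).

Section RingUnitGroup.
Variable R : comPzRingType.

Program Definition ringUnit_one := @RingUnit R 1 1 _.
Next Obligation. by rewrite mulr1. Qed.

Program Definition ringUnit_inv (u : ringUnit R) :=
  @RingUnit R (unit_inv u) (unit_val u) _.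
Next Obligation. by move=> u; rewrite mulrC unit_valK. Qed.

Program Definition ringUnit_mul (u v : ringUnit R) :=
  @RingUnit R (unit_val u * unit_val v) (unit_inv u * unit_inv v) _.
Next Obligation. by move=> u v; rewrite mulrACA !unit_valK mulr1. Qed.

Lemma ringUnit_mulA : associative ringUnit_mul.
Proof. by move=> u v w; apply: ringUnit_ext; rewrite /= mulrA. Qed.
Lemma ringUnit_mul1 : left_id ringUnit_one ringUnit_mul.
Proof. by move=> u; apply: ringUnit_ext; rewrite /= mul1r. Qed.
Lemma ringUnit_1mul : right_id ringUnit_one ringUnit_mul.
Proof. by move=> u; apply: ringUnit_ext; rewrite /= mulr1. Qed.
Lemma ringUnit_mulV : left_inverse ringUnit_one ringUnit_inv ringUnit_mul.
Proof. by move=> u; apply: ringUnit_ext; rewrite /= mulrC unit_valK. Qed.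
Lemma ringUnit_Vmul : right_inverse ringUnit_one ringUnit_inv ringUnit_mul.
Proof. by move=> u; apply: ringUnit_ext; rewrite /= unit_valK. Qed.

HB.instance Definition _ := isGroup.Build (ringUnit R)
  ringUnit_mulA ringUnit_mul1 ringUnit_1mul ringUnit_mulV ringUnit_Vmul.

End RingUnitGroup.

Program Definition ringUnit_map (R S : comPzRingType)
    (f : {rmorphism R -> S}) (u : ringUnit R) : ringUnit S :=
  @RingUnit S (f (unit_val u)) (f (unit_inv u)) _.
Next Obligation. by move=> R S f u; rewrite -rmorphM unit_valK rmorph1. Qed.

Program Definition torus (K : fieldType) (k : nat) : grpFunctor K :=
  @GrpFunctor K (fun R => {ffun 'I_k -> ringUnit R})
    (fun R S f t => [ffun i => ringUnit_map f (t i)]) _ _ _.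
Next Obligation.
move=> K k R S f x y; apply/ffunP => i; rewrite !ffunE.
by apply: ringUnit_ext; rewrite /= rmorphM.
Qed.
Next Obligation.
by move=> K k R x; apply/ffunP => i; rewrite !ffunE; exact: ringUnit_ext.
Qed.
Next Obligation.
by move=> K k R S T g f x; apply/ffunP => i; rewrite !ffunE; exact: ringUnit_ext.
Qed.

HB.instance Definition _ (aT : finType) (R : comPzRingType) :=
  GRing.PzRing_hasCommutativeMul.Build {ffun aT -> R} (@ffun_mulC aT R).

Section FunAlg.
Variables (K : fieldType) (gT : finGroupType).

Definition const_ffun (a : K) : {ffun gT -> K} := [ffun=> a].

Lemma const_ffunB : zmod_morphism const_ffun.
Proof. by move=> a b; apply/ffunP => x; rewrite !ffunE. Qed.
Lemma const_ffunM : monoid_morphism const_ffun.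
Proof. by split=> [|a b]; apply/ffunP => x; rewrite !ffunE. Qed.

HB.instance Definition _ :=
  GRing.isZmodMorphism.Build K {ffun gT -> K} const_ffun const_ffunB.
HB.instance Definition _ :=
  GRing.isMonoidMorphism.Build K {ffun gT -> K} const_ffun const_ffunM.

(* The algebra K^gT of functions on gT. *)
Definition fun_alg : comAlg K := @ComAlg K {ffun gT -> K} const_ffun.

Definition fun_delta (s : gT) : fun_alg := [ffun x => (x == s)%:R].
Definition fun_shift (s : gT) (h : fun_alg) : fun_alg :=
  [ffun x => h (s * x)%g].
Definition fun_antipode (h : fun_alg) : fun_alg := [ffun x => h x^-1%g].

Lemma fun_algE (h : fun_alg) :
  h = \sum_s comAlg_str fun_alg (h s) * fun_delta s.
Proof.
apply/ffunP => x; rewrite sum_ffunE (bigD1 x) //= big1 => [|s sx].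
  by rewrite !ffunE eqxx mulr1 addr0.
by rewrite !ffunE eq_sym (negPf sx) mulr0.
Qed.

Lemma sum_fun_delta : \sum_s fun_delta s = 1.
Proof.
apply/ffunP => x; rewrite sum_ffunE (bigD1 x) //= big1 => [|s sx].
  by rewrite !ffunE eqxx addr0.
by rewrite !ffunE eq_sym (negPf sx).
Qed.

Lemma fun_deltaM s t :
  fun_delta s * fun_delta t = if s == t then fun_delta s else 0.
Proof.
apply/ffunP => x; rewrite !ffunE; case: (eqVneq x s) => [->|xs].
  by rewrite mul1r; case: eqP; rewrite !ffunE ?eqxx.
by rewrite mul0r; case: eqP; rewrite !ffunE ?(negPf xs).
Qed.

Variable R : comAlg K.
Implicit Types f g : algHom fun_alg R.

(* The convolution product of f and g: since the comultiplication sends h to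
   \sum_s fun_delta s (x) h(s * -), it is the composite of the comultiplication,
   of f (x) g and of the multiplication of R. *)
Definition conv f g (h : fun_alg) : R :=
  \sum_s f (fun_delta s) * g (fun_shift s h).

Lemma convB f g : zmod_morphism (conv f g).
Proof.
move=> h k; rewrite /conv -sumrB; apply: eq_bigr => s _.
by rewrite -mulrBr -rmorphB; congr (_ * g _); apply/ffunP => x; rewrite !ffunE.
Qed.

Lemma convM f g : monoid_morphism (conv f g).
Proof.
split=> [|h k]; rewrite /conv.
  transitivity (\sum_s f (fun_delta s)).
    apply: eq_bigr => s _; rewrite (_ : fun_shift s 1 = 1) ?rmorph1 ?mulr1 //.
    by apply/ffunP => x; rewrite !ffunE.
  by rewrite -rmorph_sum sum_fun_delta rmorph1.
rewrite mulr_suml; apply: eq_bigr => s _; rewrite mulr_sumr (bigD1 s) //=.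
rewrite big1 => [|t ts].
  rewrite mulrACA -rmorphM fun_deltaM eqxx -rmorphM addr0.
  by congr (_ * g _); apply/ffunP => x; rewrite !ffunE.
by rewrite mulrACA -rmorphM fun_deltaM eq_sym (negPf ts) rmorph0 mul0r.
Qed.

Lemma convA f g (a : K) : conv f g (comAlg_str fun_alg a) = comAlg_str R a.
Proof.
rewrite -[RHS]mul1r -(rmorph1 f) -sum_fun_delta rmorph_sum mulr_suml.
apply: eq_bigr => s _; rewrite -(algHomA g); congr (_ * g _).
by apply/ffunP => x; rewrite !ffunE.
Qed.

Definition const_mul f g : algHom fun_alg R :=
  @AlgHom K fun_alg R (conv f g) (convB f g) (convM f g) (convA f g).

Program Definition const_one : algHom fun_alg R :=
  @AlgHom K fun_alg R (fun h => comAlg_str R (h 1%g)) _ _ _.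
Next Obligation. by move=> h k /=; rewrite !ffunE rmorphB. Qed.
Next Obligation. by split=> [|h k] /=; rewrite !ffunE ?rmorph1 ?rmorphM. Qed.
Next Obligation. by move=> a /=; rewrite !ffunE. Qed.

Program Definition const_inv f : algHom fun_alg R :=
  @AlgHom K fun_alg R (fun h => f (fun_antipode h)) _ _ _.
Next Obligation.
by move=> f h k; rewrite -rmorphB; congr (f _); apply/ffunP => x; rewrite !ffunE.
Qed.
Next Obligation.
move=> f; split=> [|h k].
  by rewrite -(rmorph1 f); congr (f _); apply/ffunP => x; rewrite !ffunE.
by rewrite -rmorphM; congr (f _); apply/ffunP => x; rewrite !ffunE.
Qed.
Next Obligation.
by move=> f a; rewrite -(algHomA f); congr (f _); apply/ffunP => x; rewrite !ffunE.
Qed.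

Lemma const_mulA : associative const_mul.
Proof.
move=> f g k; apply: algHom_ext => h /=; rewrite /conv /=.
under [RHS]eq_bigr do rewrite /conv mulr_suml.
rewrite exchange_big /=; apply: eq_bigr => s _; rewrite /conv mulr_sumr.
rewrite [RHS](reindex_inj (mulgI s)); apply: eq_bigr => t _ /=.
rewrite mulrA; congr (_ * g _ * k _); apply/ffunP => x; rewrite !ffunE ?mulgA //.
by rewrite (inj_eq (mulgI s)).
Qed.

Lemma const_mul1 : left_id const_one const_mul.
Proof.
move=> f; apply: algHom_ext => h /=; rewrite /conv /= (bigD1 1%g) //= big1.
  rewrite ffunE eqxx rmorph1 mul1r addr0; congr (f _).
  by apply/ffunP => x; rewrite !ffunE mul1g.
by move=> s s1; rewrite ffunE eq_sym (negPf s1) rmorph0 mul0r.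
Qed.

Lemma const_1mul : right_id const_one const_mul.
Proof.
move=> f; apply: algHom_ext => h /=; rewrite /conv /=.
rewrite [in RHS](fun_algE h) rmorph_sum; apply: eq_bigr => s _ /=.
by rewrite rmorphM [X in _ = X * _](algHomA f) ffunE mulg1 mulrC.
Qed.

Lemma const_mulV : left_inverse const_one const_inv const_mul.
Proof.
move=> f; apply: algHom_ext => h /=; rewrite /conv /= -(algHomA f).
under eq_bigr do rewrite -rmorphM.
rewrite -rmorph_sum; congr (f _); apply/ffunP => x; rewrite sum_ffunE.
rewrite (bigD1 x^-1%g) //= big1 => [|s sx]; rewrite !ffunE.
  by rewrite eqxx mul1r addr0 mulVg.
by rewrite eq_sym (negPf sx) mul0r.
Qed.

Lemma const_Vmul : right_inverse const_one const_inv const_mul.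
Proof.
move=> f; apply: algHom_ext => h /=; rewrite /conv /= -(algHomA f).
under eq_bigr do rewrite -rmorphM.
rewrite -rmorph_sum; congr (f _); apply/ffunP => x; rewrite sum_ffunE.
rewrite (bigD1 x) //= big1 => [|s sx]; rewrite !ffunE.
  by rewrite eqxx mul1r addr0 mulgV.
by rewrite eq_sym (negPf sx) mul0r.
Qed.

HB.instance Definition _ := isGroup.Build (algHom fun_alg R)
  const_mulA const_mul1 const_1mul const_mulV const_Vmul.

End FunAlg.

(* The constant group scheme associated with gT, represented by K^gT. *)
Program Definition constant_scheme (K : fieldType) (gT : finGroupType) :
    grpFunctor K :=
  @GrpFunctor K (fun R => algHom (fun_alg K gT) R)
    (fun R S f x => algHom_comp f x) _ _ _.
Next Obligation.
move=> K gT R S f x y; apply: algHom_ext => h /=.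
by rewrite /conv rmorph_sum; apply: eq_bigr => s _; rewrite rmorphM.
Qed.
Next Obligation. by move=> K gT R x; apply: algHom_ext. Qed.
Next Obligation. by move=> K gT R S T g f x; apply: algHom_ext. Qed.

Program Definition product_scheme (K : fieldType) (G H : grpFunctor K) :
    grpFunctor K :=
  @GrpFunctor K (fun R => (G R * H R)%type)
    (fun R S f x => (fmap G f x.1, fmap H f x.2)) _ _ _.
Next Obligation. by move=> K G H R S f x y; congr pair; exact: fmapM. Qed.
Next Obligation. by move=> K G H R [x y]; rewrite !fmap_id. Qed.
Next Obligation. by move=> K G H R S T g f [x y]; rewrite !fmap_comp. Qed.

(* Actions of H on N by group automorphisms. *)
Record group_action (K : fieldType) (N H : grpFunctor K) := GroupAction {
  gact : forall R : comAlg K, H R -> N R -> N R;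
  gact_natural : forall (R S : comAlg K) (f : algHom R S) (h : H R) (x : N R),
    gact (fmap H f h) (fmap N f x) = fmap N f (gact h x);
  gactM : forall (R : comAlg K) (h : H R),
    {morph gact h : x y / (x * y)%g};
  gact1 : forall (R : comAlg K) (x : N R), gact 1%g x = x;
  gact_comp : forall (R : comAlg K) (h k : H R) (x : N R),
    gact (h * k)%g x = gact h (gact k x)
}.

Section Semidirect.
Variables (K : fieldType) (N H : grpFunctor K) (act : group_action N H).

Definition sdprod_point (R : comAlg K) : Type := (N R * H R)%type.

HB.instance Definition _ R := Choice.on (sdprod_point R).

Section Points.
Variable R : comAlg K.
Implicit Types x y : sdprod_point R.

Definition sdprod_one : sdprod_point R := (1%g, 1%g).
Definition sdprod_mul x y : sdprod_point R :=
  ((x.1 * gact act x.2 y.1)%g, (x.2 * y.2)%g).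
Definition sdprod_inv x : sdprod_point R :=
  (gact act x.2^-1%g x.1^-1%g, x.2^-1%g).

Lemma gact_1 (h : H R) : gact act h 1%g = 1%g.
Proof. by apply: (@mulIg _ (gact act h 1%g)); rewrite -gactM !mul1g. Qed.

Lemma sdprod_mulA : associative sdprod_mul.
Proof.
by move=> x y z; rewrite /sdprod_mul /= gactM gact_comp !mulgA.
Qed.
Lemma sdprod_mul1 : left_id sdprod_one sdprod_mul.
Proof. by move=> [x h]; rewrite /sdprod_mul /= gact1 !mul1g. Qed.
Lemma sdprod_1mul : right_id sdprod_one sdprod_mul.
Proof. by move=> [x h]; rewrite /sdprod_mul /= gact_1 !mulg1. Qed.
Lemma sdprod_mulV : left_inverse sdprod_one sdprod_inv sdprod_mul.
Proof.
by move=> [x h]; rewrite /sdprod_mul /= -gactM !mulVg gact_1.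
Qed.
Lemma sdprod_Vmul : right_inverse sdprod_one sdprod_inv sdprod_mul.
Proof.
by move=> [x h]; rewrite /sdprod_mul /= -gact_comp !mulgV gact1 mulgV.
Qed.

HB.instance Definition _ := isGroup.Build (sdprod_point R)
  sdprod_mulA sdprod_mul1 sdprod_1mul sdprod_mulV sdprod_Vmul.

End Points.

Program Definition semidirect_scheme : grpFunctor K :=
  @GrpFunctor K sdprod_point
    (fun R S f x => (fmap N f x.1, fmap H f x.2)) _ _ _.
Next Obligation.
move=> R S f x y; congr pair; last exact: fmapM.
by rewrite /= gact_natural -fmapM.
Qed.
Next Obligation. by move=> R [x h]; rewrite !fmap_id. Qed.
Next Obligation. by move=> R S T g f [x h]; rewrite !fmap_comp. Qed.

End Semidirect.

(* Bijective linear endomaps. *)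
Record linAut (R : pzRingType) (M : lmodType R) := LinAut {
  linAut_fun :> M -> M;
  linAut_linear : linear linAut_fun;
  linAut_bij : bijective linAut_fun
}.

HB.instance Definition _ R M (f : @linAut R M) :=
  GRing.isLinear.Build R M M *:%R f (linAut_linear f).

Lemma linAut_ext (R : pzRingType) (M : lmodType R) (f g : linAut M) :
  f =1 g -> f = g.
Proof.
case: f g => [f a b] [g a' b'] /= /funext fg.
by case: _ / fg in a' b' *; congr LinAut; exact: Prop_irrelevance.
Qed.

HB.instance Definition _ R M := gen_eqMixin (@linAut R M).
HB.instance Definition _ R M := gen_choiceMixin (@linAut R M).

Section LinAutGroup.
Variables (R : pzRingType) (M : lmodType R).
Implicit Types f g : linAut M.

Program Definition linAut_one : linAut M := @LinAut R M id _ _.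
Next Obligation. by move=> a x y. Qed.
Next Obligation. by exists id. Qed.

Program Definition linAut_mul f g : linAut M := @LinAut R M (f \o g) _ _.
Next Obligation. by move=> f g a x y; rewrite /= !linearP. Qed.
Next Obligation. by move=> f g; apply: bij_comp; exact: linAut_bij. Qed.

Lemma linAut_inv_ex f : exists g : M -> M, cancel f g /\ cancel g f.
Proof. by case: (linAut_bij f) => g; exists g. Qed.

Program Definition linAut_inv f : linAut M :=
  @LinAut R M (projT1 (cid (linAut_inv_ex f))) _ _.
Next Obligation.
move=> f a x y; case: (cid _) => g /= [fg gf].
by apply: (can_inj fg); rewrite gf linearP /= !gf.
Qed.
Next Obligation. by move=> f; case: (cid _) => g /= [fg gf]; exists f. Qed.

Lemma linAut_invK f : cancel f (linAut_inv f).
Proof. by rewrite /=; case: (cid _) => g []. Qed.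
Lemma linAut_Kinv f : cancel (linAut_inv f) f.
Proof. by rewrite /=; case: (cid _) => g []. Qed.

Lemma linAut_mulA : associative linAut_mul.
Proof. by move=> f g h; exact: linAut_ext. Qed.
Lemma linAut_mul1 : left_id linAut_one linAut_mul.
Proof. by move=> f; exact: linAut_ext. Qed.
Lemma linAut_1mul : right_id linAut_one linAut_mul.
Proof. by move=> f; exact: linAut_ext. Qed.
Lemma linAut_mulV : left_inverse linAut_one linAut_inv linAut_mul.
Proof. by move=> f; apply: linAut_ext => x; exact: linAut_invK. Qed.
Lemma linAut_Vmul : right_inverse linAut_one linAut_inv linAut_mul.
Proof. by move=> f; apply: linAut_ext => x; exact: linAut_Kinv. Qed.

HB.instance Definition _ := isGroup.Build (linAut M)
  linAut_mulA linAut_mul1 linAut_1mul linAut_mulV linAut_Vmul.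

End LinAutGroup.

(* The scalar extension A (x)_K R of a finite dimensional space A, realized as
   R^(dim A) through the coordinates in vbasis {:A}; the universal property that
   characterizes it is ext_universal below. *)
Definition ext (K : fieldType) (A : vectType K) (R : comAlg K) : lmodType R :=
  'rV[R]_(\dim {:A}).

Definition ext_coord (K : fieldType) (A : vectType K) (i : 'I_(\dim {:A}))
  (a : A) : K := coord (vbasis {:A}) i a.

Definition ext_vec (K : fieldType) (A : vectType K) (i : 'I_(\dim {:A})) : A :=
  (vbasis {:A})`_i.

(* a |-> a (x) 1 *)
Definition ext_in (K : fieldType) (A : vectType K) (R : comAlg K) (a : A) :
  ext A R := \row_i comAlg_str R (ext_coord i a).

(* The R-bilinear product of A (x)_K R, with the structure constants of A; it
   satisfies (a (x) 1)(b (x) 1) = mu a b (x) 1 by ext_mul_in. *)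
Definition ext_mul (K : fieldType) (A : vectType K)
    (mu : {bilinear A -> A -> A}) (R : comAlg K) (x y : ext A R) : ext A R :=
  \sum_i \sum_j (x 0 i * y 0 j) *: ext_in R (mu (ext_vec i) (ext_vec j)).

Arguments ext_mul {K A} mu {R} x y.

Section ExtTheory.
Variables (K : fieldType) (A : vectType K) (R : comAlg K).

Lemma ext_vecE (a : A) : a = \sum_i ext_coord i a *: ext_vec i.
Proof. by rewrite /ext_coord /ext_vec -coord_vbasis ?memvf. Qed.

Lemma ext_inB : zmod_morphism (@ext_in K A R).
Proof. by move=> a b; apply/rowP => i; rewrite !mxE /ext_coord !raddfB. Qed.

HB.instance Definition _ :=
  GRing.isZmodMorphism.Build A (ext A R) (@ext_in K A R) ext_inB.

Lemma ext_inZ (k : K) (a : A) :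
  ext_in R (k *: a) = comAlg_str R k *: ext_in R a.
Proof. by apply/rowP => i; rewrite !mxE /ext_coord linearZ rmorphM. Qed.

Lemma ext_in_vec i : ext_in R (ext_vec i) = delta_mx 0 i :> 'rV_(\dim {:A}).
Proof.
apply/rowP => j; rewrite !mxE /ext_coord coord_free ?rmorph_nat //.
  by rewrite eqxx eq_sym.
exact: basis_free (vbasisP _).
Qed.

Lemma extE (x : ext A R) : x = \sum_i x 0 i *: ext_in R (ext_vec i).
Proof.
by rewrite [LHS]row_sum_delta; apply: eq_bigr => i _; rewrite ext_in_vec.
Qed.

Lemma ext_universal (M : lmodType R) (g : A -> M) :
    (forall a b, g (a + b) = g a + g b) ->
    (forall k a, g (k *: a) = comAlg_str R k *: g a) ->
  exists h : {linear ext A R -> M},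
    (forall a, h (ext_in R a) = g a) /\
    forall h' : {linear ext A R -> M},
      (forall a, h' (ext_in R a) = g a) -> h' =1 h.
Proof.
move=> gD gZ; pose h (x : ext A R) := \sum_i x 0 i *: g (ext_vec i).
have g0 : g 0 = 0 by rewrite -(scale0r 0) gZ rmorph0 scale0r.
have hL : linear h.
  move=> a x y; rewrite /h scaler_sumr -big_split; apply: eq_bigr => i _ /=.
  by rewrite !mxE scalerDl scalerA.
pose hl : {linear ext A R -> M} :=
  HB.pack h (GRing.isLinear.Build R (ext A R) M *:%R h hL).
exists hl; split=> [a|h' h'g x].
  rewrite {2}(ext_vecE a) /= /h.
  rewrite (big_morph g gD g0); apply: eq_bigr => i _.
  by rewrite mxE gZ.
by rewrite {1}(extE x) linear_sum; apply: eq_bigr => i _; rewrite linearZ h'g.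
Qed.

Variable mu : {bilinear A -> A -> A}.

Lemma ext_mul_linl (y : ext A R) : linear (fun x => ext_mul mu x y).
Proof.
move=> a x x'; rewrite /ext_mul scaler_sumr -big_split; apply: eq_bigr => i _.
rewrite /= scaler_sumr -big_split; apply: eq_bigr => j _ /=.
by rewrite !mxE mulrDl scalerDl scalerA mulrA.
Qed.

Lemma ext_mul_linr (x : ext A R) : linear (ext_mul mu x).
Proof.
move=> a y y'; rewrite /ext_mul scaler_sumr -big_split; apply: eq_bigr => i _.
rewrite /= scaler_sumr -big_split; apply: eq_bigr => j _ /=.
by rewrite !mxE mulrDr scalerDl scalerA mulrCA.
Qed.

Lemma ext_mul_in a b :
  ext_mul mu (ext_in R a) (ext_in R b) = ext_in R (mu a b).
Proof.
rewrite /ext_mul [in RHS](ext_vecE a) linear_sumlz raddf_sum.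
apply: eq_bigr => i _ /=; rewrite [in RHS](ext_vecE b) linear_sumr raddf_sum.
apply: eq_bigr => j _ /=; rewrite linearZl_LR linearZr_LR !ext_inZ scalerA.
by rewrite !mxE.
Qed.

End ExtTheory.

(* The map A_R -> A_S induced by f : R -> S. *)
Definition ext_map (K : fieldType) (A : vectType K) (R S : comAlg K)
    (f : algHom R S) (x : ext A R) : ext A S := map_mx f x.

Section BaseChange.
Variables (K : fieldType) (A : vectType K) (R S : comAlg K) (f : algHom R S).

(* The S-linear extension of an R-linear endomap of A_R, determined by
   base_change_fun_map. *)
Definition base_change_fun (u : ext A R -> ext A R) (y : ext A S) : ext A S :=
  \sum_i y 0 i *: ext_map f (u (ext_in R (ext_vec i))).

Lemma ext_mapD (x y : ext A R) : ext_map f (x + y) = ext_map f x + ext_map f y.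
Proof. exact: map_mxD. Qed.

Lemma ext_mapZ a (x : ext A R) : ext_map f (a *: x) = f a *: ext_map f x.
Proof. exact: map_mxZ. Qed.

Lemma ext_map_sum I (r : seq I) (F : I -> ext A R) :
  ext_map f (\sum_(i <- r) F i) = \sum_(i <- r) ext_map f (F i).
Proof.
apply: (big_morph (ext_map f)); first exact: ext_mapD.
exact: map_mx0.
Qed.

Lemma ext_map_in (a : A) : ext_map f (ext_in R a) = ext_in S a.
Proof. by apply/rowP => i; rewrite !mxE algHomA. Qed.

Lemma base_change_linear u : linear (base_change_fun u).
Proof.
move=> a x y; rewrite /base_change_fun scaler_sumr -big_split.
by apply: eq_bigr => i _ /=; rewrite !mxE scalerDl scalerA.
Qed.

Lemma base_change_fun_map (u : {linear ext A R -> ext A R}) (x : ext A R) :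
  base_change_fun u (ext_map f x) = ext_map f (u x).
Proof.
rewrite [in RHS](extE x) linear_sum ext_map_sum; apply: eq_bigr => i _.
by rewrite linearZ ext_mapZ mxE.
Qed.

(* Equality of linear maps on A_S may be checked on the image of A_R. *)
Lemma base_change_uniq (g h : {linear ext A S -> ext A S}) :
  (forall x : ext A R, g (ext_map f x) = h (ext_map f x)) -> g =1 h.
Proof.
move=> gh y; rewrite (extE y) !linear_sum; apply: eq_bigr => i _.
by rewrite !linearZ -ext_map_in gh.
Qed.

HB.instance Definition _ u :=
  GRing.isLinear.Build S (ext A S) (ext A S) *:%R (base_change_fun u)
    (base_change_linear u).

Lemma base_change_cancel (u v : {linear ext A R -> ext A R}) :
  cancel u v -> cancel (base_change_fun u) (base_change_fun v).
Proof.
move=> uv.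
have: base_change_fun v \o base_change_fun u =1 idfun; last by [].
by apply: base_change_uniq => x /=; rewrite !base_change_fun_map uv.
Qed.

Lemma base_change_bij (u : linAut (ext A R)) : bijective (base_change_fun u).
Proof.
exists (base_change_fun (linAut_inv u)); apply: base_change_cancel.
  exact: linAut_invK.
exact: linAut_Kinv.
Qed.

Definition base_change (u : linAut (ext A R)) : linAut (ext A S) :=
  LinAut (base_change_linear u) (base_change_bij u).

End BaseChange.

Record tautPoint (K : fieldType) (A : vectType K)
    (mu : {bilinear A -> A -> A}) (R : comAlg K) := TautPoint {
  taut1 : linAut (ext A R);
  taut2 : linAut (ext A R);
  taut3 : linAut (ext A R);
  tautP : forall x y : ext A R,
    taut1 (ext_mul mu x y) = ext_mul mu (taut2 x) (taut3 y)
}.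

Lemma tautPoint_ext (K : fieldType) (A : vectType K)
    (mu : {bilinear A -> A -> A}) (R : comAlg K) (f g : tautPoint mu R) :
  taut1 f = taut1 g -> taut2 f = taut2 g -> taut3 f = taut3 g -> f = g.
Proof.
case: f g => [f1 f2 f3 fP] [g1 g2 g3 gP] /= e1 e2 e3.
case: _ / e1 in gP *; case: _ / e2 in gP *; case: _ / e3 in gP *.
by congr TautPoint; exact: Prop_irrelevance.
Qed.

HB.instance Definition _ K A mu R := gen_eqMixin (@tautPoint K A mu R).
HB.instance Definition _ K A mu R := gen_choiceMixin (@tautPoint K A mu R).

Section TautGroup.
Variables (K : fieldType) (A : vectType K) (mu : {bilinear A -> A -> A}).
Variable R : comAlg K.
Implicit Types f g : tautPoint mu R.

Program Definition taut_one : tautPoint mu R := @TautPoint K A mu R 1%g 1%g 1%g _.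
Next Obligation. by []. Qed.

Program Definition taut_mul f g : tautPoint mu R :=
  @TautPoint K A mu R (taut1 f * taut1 g)%g (taut2 f * taut2 g)%g
    (taut3 f * taut3 g)%g _.
Next Obligation. by move=> f g x y /=; rewrite !tautP. Qed.

Program Definition taut_inv f : tautPoint mu R :=
  @TautPoint K A mu R (taut1 f)^-1%g (taut2 f)^-1%g (taut3 f)^-1%g _.
Next Obligation.
move=> f x y; apply: (can_inj (linAut_invK (taut1 f))).
by rewrite tautP !linAut_Kinv.
Qed.

Lemma taut_mulA : associative taut_mul.
Proof. by move=> f g h; apply: tautPoint_ext; rewrite /= mulgA. Qed.
Lemma taut_mul1 : left_id taut_one taut_mul.
Proof. by move=> f; apply: tautPoint_ext; rewrite /= mul1g. Qed.
Lemma taut_1mul : right_id taut_one taut_mul.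
Proof. by move=> f; apply: tautPoint_ext; rewrite /= mulg1. Qed.
Lemma taut_mulV : left_inverse taut_one taut_inv taut_mul.
Proof. by move=> f; apply: tautPoint_ext; rewrite /= mulVg. Qed.
Lemma taut_Vmul : right_inverse taut_one taut_inv taut_mul.
Proof. by move=> f; apply: tautPoint_ext; rewrite /= mulgV. Qed.

HB.instance Definition _ := isGroup.Build (tautPoint mu R)
  taut_mulA taut_mul1 taut_1mul taut_mulV taut_Vmul.

End TautGroup.

Lemma base_change_taut (K : fieldType) (A : vectType K)
    (mu : {bilinear A -> A -> A}) (R S : comAlg K) (f : algHom R S)
    (u : tautPoint mu R) (x y : ext A S) :
  base_change f (taut1 u) (ext_mul mu x y) =
  ext_mul mu (base_change f (taut2 u) x) (base_change f (taut3 u) y).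
Proof.
have mapM (a b : ext A R) :
    ext_map f (ext_mul mu a b) = ext_mul mu (ext_map f a) (ext_map f b).
  rewrite /ext_mul ext_map_sum; apply: eq_bigr => i _; rewrite ext_map_sum.
  by apply: eq_bigr => j _; rewrite ext_mapZ ext_map_in rmorphM !mxE.
pose rl (z : ext A S) : {linear ext A S -> ext A S} :=
  HB.pack (ext_mul mu z) (GRing.isLinear.Build S (ext A S) (ext A S) *:%R
    (ext_mul mu z) (ext_mul_linr mu z)).
pose ll (z : ext A S) : {linear ext A S -> ext A S} :=
  HB.pack (fun x => ext_mul mu x z) (GRing.isLinear.Build S (ext A S) (ext A S)
    *:%R (fun x => ext_mul mu x z) (ext_mul_linl mu z)).
pose c1 : {linear _ -> _} := base_change f (taut1 u).
pose c2 : {linear _ -> _} := base_change f (taut2 u).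
pose c3 : {linear _ -> _} := base_change f (taut3 u).
have step (a : ext A R) : c1 \o rl (ext_map f a) =1 rl (c2 (ext_map f a)) \o c3.
  apply: (base_change_uniq (f := f)) => b /=.
  rewrite -mapM (base_change_fun_map f (taut1 u)).
  rewrite (base_change_fun_map f (taut2 u)) (base_change_fun_map f (taut3 u)).
  by rewrite -mapM; congr (ext_map f _); exact: tautP.
have: c1 \o ll y =1 ll (c3 y) \o c2; last exact.
by apply: (base_change_uniq (f := f)) => a; exact: step.
Qed.

(* The functor R |-> Taut(A_R). *)
Program Definition Taut (K : fieldType) (A : vectType K)
    (mu : {bilinear A -> A -> A}) : grpFunctor K :=
  @GrpFunctor K (tautPoint mu)
    (fun R S f u => TautPoint (base_change_taut f u)) _ _ _.
Next Obligation.
move=> K A mu R S f u v.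
have e (p q : linAut (ext A R)) :
    base_change f (p * q)%g = (base_change f p * base_change f q)%g.
  apply: linAut_ext; apply: (base_change_uniq (f := f)) => x.
  rewrite [LHS](base_change_fun_map f (linAut_mul p q)).
  transitivity (base_change f p (base_change f q (ext_map f x))); last by [].
  rewrite [X in base_change f p X](base_change_fun_map f q).
  by rewrite [RHS](base_change_fun_map f p).
by apply: tautPoint_ext; exact: e.
Qed.
Next Obligation.
move=> K A mu R u.
have e (v : linAut (ext A R)) : base_change (algHom_id R) v = v.
  apply: linAut_ext => x; rewrite -[x in LHS](map_mx_id _ (f := idfun)) //.
  rewrite [LHS](base_change_fun_map (algHom_id R)).
  exact: map_mx_id.
by apply: tautPoint_ext; exact: e.
Qed.
Next Obligation.
move=> K A mu R S T g f u.
have e (v : linAut (ext A R)) :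
    base_change (algHom_comp g f) v = base_change g (base_change f v).
  apply: linAut_ext; apply: (@base_change_uniq K A R T (algHom_comp g f)) => x.
  rewrite [LHS]base_change_fun_map /ext_map [in LHS]map_mx_comp.
  rewrite [in RHS]map_mx_comp [RHS](base_change_fun_map g (base_change f v)).
  by rewrite [X in ext_map g X](base_change_fun_map f v).
by apply: tautPoint_ext; exact: e.
Qed.

(* e is a natural basis for the product mu. *)
Definition natural_basis (K : fieldType) (A : vectType K)
    (mu : {bilinear A -> A -> A}) (n : nat) (e : n.-tuple A) : Prop :=
  basis_of {:A} e /\
  forall i j : 'I_n, i != j -> mu (tnth e i) (tnth e j) = 0.

Definition evolution_algebra (K : fieldType) (A : vectType K)
    (mu : {bilinear A -> A -> A}) (n : nat) : Prop :=
  exists e : n.-tuple A, natural_basis mu e.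

(* A^2 = A, where A^2 is the linear span of the products. *)
Definition perfect (K : fieldType) (A : vectType K)
    (mu : {bilinear A -> A -> A}) : Prop :=
  forall a : A, exists s : seq (K * (A * A)),
    a = \sum_(p <- s) p.1 *: mu p.2.1 p.2.2.

(* Main.v *)
Require Import Defs.
From HB Require Import structures.
From mathcomp Require Import all_boot all_order all_fingroup all_algebra sesquilinear.
From mathcomp Require Import boolp classical_sets topology.
From mathcomp Require Import -(notations) mpoly.

(** Let [e] be a natural basis. Perfectness says that the squares [e_k * e_k]
    form a second basis, and when the factors are written in the first basis
    and the product in the second, the multiplication of the scalar extension
    to [R] becomes the componentwise multiplication of the ring [R^n]
    ([ext_mul_frame]). A ternary automorphism is therefore a triple of R-linear
    bijections of [R^n] with [F1 (x * y) = F2 x * F3 y]. Setting [x] or [y] to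
    [1] shows that [b := F2 1] and [c := F3 1] are units and that
    [F2 = b * F], [F3 = c * F], [F1 = b * c * F] for a single R-algebra
    automorphism [F] of [R^n] ([vec_autotopism]). The automorphisms of that
    algebra are the R-points of the constant scheme of ['S_n]: locally on
    Spec R they permute the coordinates ([vec_algebra_automorphism]). So the
    ternary automorphisms form the semidirect product of two copies of the
    n-dimensional torus by ['S_n], which permutes the coordinates of both
    copies simultaneously ([Taut_semidirect]); forgetting the group law leaves
    the direct product.

    Representability and the identity component are then statements about a
    semidirect product of a group functor [N] with the constant scheme of a
    finite group. If [L] represents [N], the algebra of functions from the
    group to [L] represents the product ([universal_product_constant]); for a
    torus, [L] is the ring of Laurent polynomials ([laurent_universal]).
    Whenever [L] is a domain, the identity component is [N]
    ([identity_component_semidirect]): let [eps] be the idempotent coordinate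
    that detects the neutral element of the finite group. The set where [eps]
    does not vanish is open and closed, and it is the closure of one point,
    the kernel of the projection onto [L]; hence it is connected and is the
    component. An R-point factors through it exactly when the image of
    [eps] lies in no prime of [R], which for an idempotent means that it is [1]
    ([idem_eq1]), i.e. that the component of the point in the finite group is
    trivial. *)

Set Implicit Arguments.
Unset Strict Implicit.
Unset Printing Implicit Defensive.

Import GRing.Theory.

Local Open Scope ring_scope.

(** * Idempotents and the Zariski topology *)

(** An ideal that is maximal among those containing no power of [c] is prime:
    if [x] and [y] lie outside it, some power of [c] is in the ideal enlarged
    by [x] and another in the ideal enlarged by [y], and the product of the
    two is in the ideal enlarged by [x * y]. *)
Lemma exists_prime_avoiding (R : comPzRingType) (c : R) :
  (forall k, c ^+ k <> 0) -> exists q : spec R, ~ spec_set q c.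
Proof.
move=> c_nnil.
(* Membership of 0 is left out so that the union of the empty chain is still
   of this kind; maximality gives it back as I0. *)
pose avoids (I : set R) := [/\ forall x y, I x -> I y -> I (x + y),
  forall a x, I x -> I (a * x) & forall k, ~ I (c ^+ k)].
have [F chainF totF|I [[ID IM Ic] Imax]] := @Zorn_bigcup R avoids.
  split=> [x y [I FI Ix] [J FJ Jy]|a x [I FI Ix]|k [I FI]].
  - have [ID _ _] := chainF _ FI; have [JD _ _] := chainF _ FJ.
    case: (totF _ _ FI FJ) => [IJ|JI].
      by exists J => //; apply: JD => //; exact: IJ.
    by exists I => //; apply: ID => //; exact: JI.
  - by have [_ IM _] := chainF _ FI; exists I => //; exact: IM.
  - by have [_ _ Ic] := chainF _ FI; exact: Ic.
have I0 : I 0.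
  apply: contrapT => nI0.
  have Iempty y : ~ I y by move=> Iy; apply: nI0; rewrite -(mul0r y); exact: IM.
  apply: (Imax [set 0]%classic).
    by split=> [y /Iempty//|/(_ 0 erefl)/Iempty].
  split=> [_ _ -> ->|a _ ->|k]; rewrite ?addr0 ?mulr0 //; exact: c_nnil.
have spanP x : ~ I x -> exists k i a, I i /\ c ^+ k = i + a * x.
  move=> nIx; apply: contrapT => nspan.
  apply: (Imax [set y | exists i a, I i /\ y = i + a * x]%classic).
    split=> [y Iy|sub]; first by exists y, 0; rewrite mul0r addr0.
    by apply: nIx; apply: sub; exists 0, 1; rewrite mul1r add0r.
  split=> [_ _ [i [a [Ii ->]]] [j [b [Ij ->]]]|b _ [i [a [Ii ->]]]|
           k [i [a Ha]]].
  - by exists (i + j), (a + b); split; [exact: ID|rewrite mulrDl addrACA].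
  - by exists (b * i), (b * a); split; [exact: IM|rewrite mulrDr mulrA].
  - by apply: nspan; exists k, i, a.
have Iprime : prime_ideal I.
  split=> // [/(Ic 0%N)//|x y Ixy].
  apply: contrapT => /not_orP[].
  move=> /spanP[k [i [a [Ii ek]]]] /spanP[l [j [b [Ij el]]]].
  apply: (Ic (k + l)%N); rewrite exprD ek el mulrDl [a * x * _]mulrDr addrA.
  apply: (ID _ _ _); last by rewrite mulrACA; exact: IM.
  by apply: ID; [rewrite mulrC|]; exact: IM.
by exists (Spec Iprime) => Ic1; apply: (Ic 1%N); rewrite expr1.
Qed.

Lemma connected_component_clopen (T : topologicalType) (D : set T) (x : T) :
  D x -> open D -> closed D -> connected D ->
  connected_component [set: T]%classic x = D.
Proof.
move=> Dx openD closedD connD; apply/seteqP; split; last first.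
  exact: connected_component_max.
set C := connected_component _ _.
have <- : (C `&` D = C)%classic; last by move=> y [].
apply: component_connected.
- by exists x; split=> //; exact: connected_component_refl.
- by exists D.
- by exists D.
Qed.

Section BasicOpens.
Variable R : comPzRingType.

Definition basic_open (f : R) : set (spec R) :=
  [set q | ~ spec_set q f]%classic.

Lemma basic_open_open f : open (basic_open f).
Proof.
exists [set f]%classic; apply/seteqP; split=> q /=; first by exists f.
by case=> _ ->.
Qed.

Variable e : R.
Hypothesis e_idem : e * e = e.

Lemma spec_idem (q : spec R) : ~ spec_set q e <-> spec_set q (1 - e).
Proof.
have q_prime := specP q; split=> [nqe|qe' qe].
  have /(prime_idealM q_prime)[//|//] : spec_set q (e * (1 - e)).
  by rewrite mulrBr mulr1 e_idem subrr; exact: prime_ideal0.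
apply: (prime_ideal1 q_prime); rewrite -[1](subrK e).
exact: prime_idealD.
Qed.

Lemma basic_open_closed : closed (basic_open e).
Proof.
rewrite -[basic_open e]setCK; apply: open_closedC.
suff -> : (~` basic_open e = basic_open (1 - e))%classic.
  exact: basic_open_open.
apply/seteqP; split=> q; rewrite /basic_open /setC /=;
  by rewrite (propext (spec_idem q)).
Qed.

(** Every point of the basic open set of [e] contains [eta], because [a * e = 0]
    lies in each prime and [e] does not; so this set is the closure of [eta]. *)
Lemma basic_open_connected (eta : spec R) :
    basic_open e eta ->
    (forall a, spec_set eta a -> a * e = 0) ->
  connected (basic_open e).
Proof.
move=> eta_e eta_gen.
suff -> : basic_open e = closure [set eta]%classic.
  by apply: connected_closure; exact: connected1.
apply/seteqP; split=> q; last first.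
  have D_closure := (closure_id _).1 basic_open_closed.
  by rewrite [X in _ -> X q]D_closure; apply: closure_subset => _ ->.
move=> qe B; rewrite nbhsE => -[U [openU Uq] UB]; exists eta; split=> //.
apply: UB; have [E UE] := openU; move: Uq; rewrite UE => -[f Ef qf].
exists f => // eta_f; apply: qf.
have /(prime_idealM (specP q))[//|/qe[]] : spec_set q (f * e).
by rewrite eta_gen //; exact: prime_ideal0 (specP q).
Qed.

(** Otherwise [1 - e] is a nonzero idempotent, hence not nilpotent, and some
    prime misses it; that prime contains [e]. *)
Lemma idem_eq1 : (forall q : spec R, basic_open e q) -> e = 1.
Proof.
move=> e_units; apply: contrapT => e1.
have idem_pow k : (1 - e) ^+ k.+1 = 1 - e.
  elim: k => [|k IH]; rewrite ?expr1 // exprS IH mulrBl mul1r mulrBr mulr1.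
  by rewrite e_idem subrr subr0.
have [[|k]|q []] := @exists_prime_avoiding R (1 - e).
- move=> R0; apply: e1.
  by rewrite -[e]mulr1 -[RHS]mulr1 -(expr0 (1 - e)) R0 !mulr0.
- by rewrite idem_pow => /eqP; rewrite subr_eq0 => /eqP/esym.
- exact/spec_idem/e_units.
Qed.

End BasicOpens.

(** * Points of constant group schemes *)

Section ConstantPoints.
Variables (K : fieldType) (gT : finGroupType).
Local Notation delta := (@Defs.fun_delta K gT).

(** A point [h] of the constant scheme cuts Spec R into the clopen pieces on
    which [h (delta s)] is [1]; [glue h a] is the function equal to [a s] on
    the piece of [s]. All identities below can be read piece by piece. *)
Definition glue (R : comAlg K) (h : algHom (fun_alg K gT) R)
    (a : gT -> R) : R :=
  \sum_s h (delta s) * a s.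

Section OnePoint.
Variables (R : comAlg K) (h : algHom (fun_alg K gT) R).

Lemma sum_const_delta : \sum_s h (delta s) = 1.
Proof. by rewrite -rmorph_sum sum_fun_delta rmorph1. Qed.

Lemma const_deltaM s t :
  h (delta s) * h (delta t) = if s == t then h (delta s) else 0.
Proof. by rewrite -rmorphM fun_deltaM; case: eqP => // _; rewrite rmorph0. Qed.

Lemma eq_glue a b : a =1 b -> glue h a = glue h b.
Proof. by move=> ab; apply: eq_bigr => s _; rewrite ab. Qed.

Lemma glue_delta s a : h (delta s) * glue h a = h (delta s) * a s.
Proof.
rewrite /glue mulr_sumr (bigD1 s) //= big1 => [|t ts].
  by rewrite mulrA const_deltaM eqxx addr0.
by rewrite mulrA const_deltaM eq_sym (negPf ts) mul0r.
Qed.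

Lemma glueD a b : glue h (fun s => a s + b s) = glue h a + glue h b.
Proof. by rewrite /glue -big_split; apply: eq_bigr => s _; rewrite mulrDr. Qed.

Lemma glueM a b : glue h (fun s => a s * b s) = glue h a * glue h b.
Proof.
rewrite {2}/glue mulr_suml; apply: eq_bigr => s _.
by rewrite mulrA [RHS]mulrAC glue_delta mulrAC.
Qed.

Lemma glue_cst c : glue h (fun=> c) = c.
Proof. by rewrite /glue -mulr_suml sum_const_delta mul1r. Qed.

Lemma glue_prod I (r : seq I) (a : I -> gT -> R) :
  glue h (fun s => \prod_(i <- r) a i s) = \prod_(i <- r) glue h (a i).
Proof.
elim: r => [|i r IH].
  by rewrite big_nil -[RHS]glue_cst; apply: eq_glue => s; rewrite big_nil.
by rewrite big_cons -IH -glueM; apply: eq_glue => s; rewrite big_cons.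
Qed.

Lemma glueB a b : glue h (fun s => a s - b s) = glue h a - glue h b.
Proof.
apply/eqP; rewrite eq_sym subr_eq -glueD; apply/eqP/eq_glue => s.
by rewrite subrK.
Qed.

Lemma glue_str (x : fun_alg K gT) : glue h (fun s => comAlg_str R (x s)) = h x.
Proof.
rewrite [in RHS](fun_algE x) rmorph_sum; apply: eq_bigr => s _.
by rewrite rmorphM [X in _ = X * _](algHomA h) mulrC.
Qed.

End OnePoint.

Lemma const_ext (R : comAlg K) (h k : algHom (fun_alg K gT) R) :
  (forall s, h (delta s) = k (delta s)) -> h = k.
Proof.
move=> hk; apply: algHom_ext => x.
by rewrite -!glue_str; apply: eq_bigr => s _; rewrite hk.
Qed.

(** A point of the constant scheme amounts to a partition of unity of [R] into
    orthogonal idempotents indexed by the group. *)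
Lemma const_exists (R : comAlg K) (d : gT -> R) :
    \sum_s d s = 1 -> (forall s t, s != t -> d s * d t = 0) ->
  exists h : algHom (fun_alg K gT) R, forall s, h (delta s) = d s.
Proof.
move=> sum_d orth_d.
have idem_d s : d s * d s = d s.
  rewrite -[RHS]mulr1 -sum_d mulr_sumr (bigD1 s) //= big1 ?addr0 // => t ts.
  by rewrite orth_d // eq_sym.
pose h (x : fun_alg K gT) := \sum_s comAlg_str R (x s) * d s.
have hB : zmod_morphism h.
  move=> x y; rewrite /h -sumrB; apply: eq_bigr => s _.
  by rewrite !ffunE rmorphB mulrBl.
have hM : monoid_morphism h.
  split=> [|x y].
    by rewrite -sum_d; apply: eq_bigr => s _; rewrite ffunE rmorph1 mul1r.
  rewrite /h mulr_suml; apply: eq_bigr => s _; rewrite mulr_sumr (bigD1 s) //=.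
  rewrite big1 => [|t ts]; first by rewrite mulrACA idem_d addr0 ffunE rmorphM.
  by rewrite mulrACA orth_d ?mulr0 // eq_sym.
have hA c : h (comAlg_str (fun_alg K gT) c) = comAlg_str R c.
  rewrite -[RHS]mulr1 -sum_d mulr_sumr; apply: eq_bigr => s _.
  by rewrite ffunE.
exists (AlgHom hB hM hA) => s; rewrite /= /h (bigD1 s) //= big1 => [|t ts].
  by rewrite ffunE eqxx rmorph1 mul1r addr0.
by rewrite ffunE (negPf ts) rmorph0 mul0r.
Qed.

Lemma glue_map (R S : comAlg K) (f : algHom R S)
    (h : constant_scheme K gT R) a :
  f (glue h a) = glue (Defs.fmap (constant_scheme K gT) f h) (f \o a).
Proof. by rewrite rmorph_sum; apply: eq_bigr => s _; rewrite rmorphM. Qed.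

Lemma glue1 (R : comAlg K) a : glue (1%g : constant_scheme K gT R) a = a 1%g.
Proof.
rewrite /glue (bigD1 1%g) //= big1 => [|s s1]; rewrite ffunE.
  by rewrite eqxx rmorph1 mul1r addr0.
by rewrite eq_sym (negPf s1) rmorph0 mul0r.
Qed.

(** On the intersection of the piece of [s] for [h] with the piece of [t] for
    [k], the product [h * k] takes the value [s * t]. *)
Lemma glueMg (R : comAlg K) (h k : constant_scheme K gT R) a :
  glue (h * k)%g a = glue h (fun s => glue k (fun t => a (s * t)%g)).
Proof.
rewrite /glue /= /conv; under eq_bigr do rewrite mulr_suml.
rewrite exchange_big /=; apply: eq_bigr => s _.
rewrite mulr_sumr (reindex_inj (mulgI s)); apply: eq_bigr => t _.
rewrite mulrA; congr (_ * k _ * _); apply/ffunP => x; rewrite !ffunE.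
by rewrite (inj_eq (mulgI s)).
Qed.

Lemma const_eq1 (R : comAlg K) (h : constant_scheme K gT R) :
  h (delta 1%g) = 1 -> h = 1%g.
Proof.
move=> h1; apply: const_ext => s; rewrite -[LHS]mul1r -{1}h1 const_deltaM.
rewrite [RHS]/= ffunE; case: eqP => [_|_]; first by rewrite h1 rmorph1.
by rewrite rmorph0.
Qed.

End ConstantPoints.

(** * Universal points *)

Lemma natural_inverse (K : fieldType) (G H : grpFunctor K)
    (alpha : forall R, G R -> H R) :
    (forall R, bijective (alpha R)) -> natural alpha ->
  exists beta : forall R, H R -> G R,
    [/\ natural beta, forall R, cancel (alpha R) (beta R) &
        forall R, cancel (beta R) (alpha R)].
Proof.
move=> alpha_bij alpha_nat.
have inv_ex R : exists b, cancel (alpha R) b /\ cancel b (alpha R).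
  by case: (alpha_bij R) => b ab ba; exists b.
pose beta R := projT1 (cid (inv_ex R)).
have alphaK R : cancel (alpha R) (beta R) by rewrite /beta; case: cid => b [].
have betaK R : cancel (beta R) (alpha R) by rewrite /beta; case: cid => b [].
exists beta; split=> // R S f x; apply: (can_inj (alphaK S)).
by rewrite alpha_nat !betaK.
Qed.

Lemma group_isomorphic_sym (K : fieldType) (G H : grpFunctor K) :
  group_isomorphic G H -> group_isomorphic H G.
Proof.
move=> [alpha [[alpha_nat alphaM] alpha_bij]].
have [beta [beta_nat alphaK betaK]] := natural_inverse alpha_bij alpha_nat.
exists beta; split; last by move=> R; exists (alpha R).
split=> // R x y; apply: (can_inj (alphaK R)).
by rewrite alphaM !betaK.
Qed.

(** A representation with its algebra and its point as separate arguments, so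
    that both can be prescribed. *)
Definition universal (K : fieldType) (G : grpFunctor K) (O : comAlg K)
    (u : G O) : Prop :=
  forall (R : comAlg K) (g : G R),
    exists! phi : algHom O R, Defs.fmap G phi u = g.

Lemma universal_iso (K : fieldType) (G H : grpFunctor K) (O : comAlg K)
    (alpha : forall R, G R -> H R) (u : G O) :
    natural alpha -> (forall R, bijective (alpha R)) ->
  universal u -> universal (alpha O u).
Proof.
move=> alpha_nat alpha_bij u_univ R h.
have [beta [_ alphaK betaK]] := natural_inverse alpha_bij alpha_nat.
have [phi [phiu phi_uniq]] := u_univ R (beta R h).
exists phi; split=> [|psi psiu]; first by rewrite -alpha_nat phiu betaK.
by apply: phi_uniq; rewrite -psiu -alpha_nat alphaK.
Qed.

Section PowerAlgebra.
Variables (K : fieldType) (gT : finGroupType) (L : comAlg K).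

Definition pow_cst (a : L) : {ffun gT -> L} := [ffun=> a].

Lemma pow_cstB : zmod_morphism pow_cst.
Proof. by move=> a b; apply/ffunP => x; rewrite !ffunE. Qed.
Lemma pow_cstM : monoid_morphism pow_cst.
Proof. by split=> [|a b]; apply/ffunP => x; rewrite !ffunE. Qed.

HB.instance Definition _ :=
  GRing.isZmodMorphism.Build L {ffun gT -> L} pow_cst pow_cstB.
HB.instance Definition _ :=
  GRing.isMonoidMorphism.Build L {ffun gT -> L} pow_cst pow_cstM.

Definition pow_alg : comAlg K :=
  @ComAlg K {ffun gT -> L} (pow_cst \o comAlg_str L).

Definition pow_in : algHom L pow_alg :=
  @AlgHom K L pow_alg pow_cst pow_cstB pow_cstM (fun=> erefl).

Program Definition pow_at (s : gT) : algHom pow_alg L :=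
  @AlgHom K pow_alg L (fun x => x s) _ _ _.
Next Obligation. by move=> s x y; rewrite !ffunE. Qed.
Next Obligation. by split=> [|x y]; rewrite !ffunE. Qed.
Next Obligation. by move=> s a; rewrite /= ffunE. Qed.

Program Definition pow_const : constant_scheme K gT pow_alg :=
  @AlgHom K (fun_alg K gT) pow_alg
    (fun x => [ffun s => comAlg_str L (x s)]) _ _ _.
Next Obligation. by move=> x y; apply/ffunP => s; rewrite !ffunE rmorphB. Qed.
Next Obligation.
by split=> [|x y]; apply/ffunP => s; rewrite !ffunE ?rmorph1 ?rmorphM.
Qed.
Next Obligation. by move=> a; apply/ffunP => s; rewrite !ffunE. Qed.

Lemma pow_algE (x : pow_alg) :
  x = \sum_s pow_const (Defs.fun_delta K s) * pow_in (x s).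
Proof.
apply/ffunP => t; rewrite sum_ffunE (bigD1 t) //= big1 => [|s st].
  by rewrite !ffunE eqxx rmorph1 mul1r addr0.
by rewrite !ffunE eq_sym (negPf st) rmorph0 mul0r.
Qed.

(** A morphism out of [L^gT] into [R] is a point of the constant scheme, which
    cuts Spec R into pieces, and on the piece of [s] a morphism out of the
    factor of index [s]. These local morphisms out of [L] glue to one. *)
Lemma universal_product_constant (N : grpFunctor K) (u : N L) :
  universal u ->
  universal ((Defs.fmap N pow_in u, pow_const) :
    product_scheme N (constant_scheme K gT) pow_alg).
Proof.
move=> u_univ R [t h]; have [f [fu f_uniq]] := u_univ R t.
pose phi (x : pow_alg) : R := glue h (fun s => f (x s)).
have phiB : zmod_morphism phi.
  move=> x y; rewrite /phi -glueB; apply: eq_glue => s.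
  by rewrite !ffunE rmorphB.
have phiM : monoid_morphism phi.
  split=> [|x y].
    by rewrite -[RHS](glue_cst h); apply: eq_glue => s; rewrite ffunE rmorph1.
  by rewrite /phi -glueM; apply: eq_glue => s; rewrite !ffunE rmorphM.
have phiA c : phi (comAlg_str pow_alg c) = comAlg_str R c.
  rewrite -[RHS](glue_cst h); apply: eq_glue => s.
  by rewrite ffunE (algHomA f).
exists (AlgHom phiB phiM phiA); split=> [|psi [psi_t psi_h]].
  congr pair; last first.
    apply: algHom_ext => x; rewrite -[RHS]glue_str; apply: eq_glue => s.
    by rewrite ffunE (algHomA f).
  rewrite /= -Defs.fmap_comp -fu; congr (Defs.fmap N _ u).
  apply: algHom_ext => a.
  by rewrite -[RHS](glue_cst h); apply: eq_glue => s; rewrite ffunE.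
have psi_f : f = algHom_comp psi pow_in.
  by apply: f_uniq; rewrite Defs.fmap_comp.
apply: algHom_ext => x; rewrite [in RHS](pow_algE x) rmorph_sum.
apply: eq_bigr => s _; rewrite rmorphM psi_f -psi_h.
by [].
Qed.

End PowerAlgebra.

(** * The identity component of a semidirect product with a constant group *)

Lemma classifyP (K : fieldType) (G : grpFunctor K) (rep : representation G)
    (R : comAlg K) (g : G R) :
  Defs.fmap G (classify rep g) (univ_point rep) = g.
Proof. by rewrite /classify; case: cid => phi []. Qed.

Lemma universal_endo (K : fieldType) (G : grpFunctor K) (O : comAlg K) (u : G O)
    (phi : algHom O O) :
  universal u -> Defs.fmap G phi u = u -> phi = algHom_id O.
Proof.
move=> u_univ phiu; have [psi [_ psi_uniq]] := u_univ O u.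
by rewrite -(psi_uniq _ phiu); apply: psi_uniq; exact: Defs.fmap_id.
Qed.

Lemma fmap1 (K : fieldType) (G : grpFunctor K) (R S : comAlg K)
    (f : algHom R S) :
  Defs.fmap G f 1%g = 1%g.
Proof. by apply: (mulIg (Defs.fmap G f 1%g)); rewrite -fmapM !mul1g. Qed.

(** The proof passes from the given representation to the concrete algebra
    [L^gT], where [eps] becomes the indicator of the neutral element: an
    element whose coordinate at the neutral element is zero is killed by
    [eps], and this makes the kernel of that coordinate a generic point. *)
Theorem identity_component_semidirect (K : fieldType) (gT : finGroupType)
    (G N : grpFunctor K) (act : group_action N (constant_scheme K gT))
    (L : comAlg K) (t : N L) (rep : representation G) :
    universal t -> prime_ideal [set 0 : L]%classic ->
    group_isomorphic G (semidirect_scheme act) ->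
  identity_component_isomorphic rep N.
Proof.
move=> t_univ L_domain [alpha [[alpha_nat alphaM] alpha_bij]].
have [beta [beta_nat alphaK betaK]] := natural_inverse alpha_bij alpha_nat.
pose O := coord_alg rep; pose u : G O := univ_point rep.
pose comp R (g : G R) : constant_scheme K gT R := (alpha R g).2.
pose eps : O := comp O u (Defs.fun_delta K 1%g).
have eps_idem : eps * eps = eps by rewrite /eps const_deltaM eqxx.
have compE R (phi : algHom O R) :
    comp R (Defs.fmap G phi u) (Defs.fun_delta K 1%g) = phi eps.
  by rewrite /comp alpha_nat.
have alpha1 R : alpha R 1%g = 1%g.
  by apply: (mulIg (alpha R 1%g)); rewrite -alphaM !mul1g.
have component_eq : identity_component_set rep = basic_open eps.
  apply: connected_component_clopen.
  - rewrite /basic_open /identity_point /= -compE classifyP /comp alpha1.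
    by rewrite /= ffunE eqxx => /eqP; rewrite oner_eq0.
  - exact: basic_open_open.
  - exact: basic_open_closed.
  pose P := pow_alg gT L.
  pose v : G P := beta P (Defs.fmap N (pow_in gT L) t, pow_const gT L).
  have v_univ : universal v.
    apply: (universal_iso (alpha := beta) (H := G)
      (G := product_scheme N (constant_scheme K gT))).
    - exact: beta_nat.
    - by move=> R; exists (alpha R).
    - exact: universal_product_constant.
  have [phi [phi_u _]] := univ_pointP rep v.
  have [psi [psi_v _]] := v_univ O u.
  have phiK : algHom_comp psi phi = algHom_id O.
    by apply: universal_endo (univ_pointP rep) _; rewrite Defs.fmap_comp phi_u.
  have phi_eps : phi eps = pow_const gT L (Defs.fun_delta K 1%g).
    by rewrite -compE phi_u /comp betaK.
  pose q0 : spec L := Spec L_domain.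
  apply: (basic_open_connected eps_idem
      (eta := spec_map (algHom_comp (@pow_at K gT L 1%g) phi) q0) _ _)
    => [|a /= a0].
    rewrite /basic_open /= phi_eps !ffunE eqxx rmorph1.
    exact: prime_ideal1 L_domain.
  have <- : psi (phi (a * eps)) = a * eps.
    exact: (congr1 (fun f : algHom O O => f (a * eps)) phiK).
  have -> : phi (a * eps) = phi a * phi eps by exact: rmorphM.
  rewrite phi_eps (_ : _ * _ = 0) ?rmorph0 //.
  apply/ffunP => s; rewrite !ffunE; case: eqP => [->|_].
    by rewrite a0 mul0r.
  by rewrite rmorph0 mulr0.
have in_componentP R (g : G R) :
    in_identity_component rep g <-> comp R g = 1%g.
  pose f : R := classify rep g eps.
  have fE : comp R g (Defs.fun_delta K 1%g) = f by rewrite /f -compE classifyP.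
  have f_idem : f * f = f by rewrite /f -rmorphM eps_idem.
  rewrite /in_identity_component component_eq; split=> [f_units|g1].
    by apply: const_eq1; rewrite fE; apply: idem_eq1 => // q; exact: f_units.
  move=> q; rewrite /basic_open /= -/f -fE g1 /= ffunE eqxx rmorph1.
  exact: prime_ideal1 (specP q).
exists (fun R x => beta R (x, 1%g)); split=> [|R x y|R g].
- split=> [R S f x|R x y].
    rewrite -beta_nat; congr (beta S _); congr pair.
    exact/esym/fmap1.
  apply: (can_inj (alphaK R)); rewrite alphaM !betaK.
  by congr pair; [rewrite Defs.gact1|rewrite mul1g].
- by move=> /= /(congr1 (alpha R)); rewrite !betaK => -[].
- rewrite in_componentP; split=> [g1|[x <-]]; last by rewrite /comp betaK.
  exists (alpha R g).1; rewrite -[RHS]alphaK; congr (beta R _).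
  by rewrite -g1 /comp; case: (alpha R g).
Qed.

(** * Laurent polynomials and the torus *)

Section LaurentPolynomials.
Variables (K : fieldType) (m : nat).

Local Notation pol := (mpoly m K).
Local Notation polX i := (mpolyX K (mnm1 i) : pol).
Local Notation frac := (@FracField.tofrac pol).

(** The zero ring is among the targets; the zero map evaluates everything
    there, and over a nonzero ring the usual evaluation morphism applies. *)
Lemma mpoly_eval (R : comAlg K) (t : 'I_m -> R) :
  exists f : {rmorphism pol -> R},
    (forall c, f (mpolyC m c) = comAlg_str R c) /\ forall i, f (polX i) = t i.
Proof.
have [R0|R1] := eqVneq (1 : R) 0.
  have all0 (x y : R) : x = y by rewrite -[x]mulr1 -[y]mulr1 R0 !mulr0.
  pose f (_ : pol) : R := 0.
  have fB : zmod_morphism f by move=> *; exact: all0.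
  have fM : monoid_morphism f by split=> [|x y]; exact: all0.
  pose g : {rmorphism pol -> R} :=
    HB.pack f (GRing.isZmodMorphism.Build pol R f fB)
      (GRing.isMonoidMorphism.Build pol R f fM).
  by exists g; split=> *; exact: all0.
pose S : comNzRingType :=
  HB.pack (GRing.ComPzRing.sort R) (GRing.PzSemiRing_isNonZero.Build R R1).
pose str : {rmorphism K -> S} := comAlg_str R.
exists (mmap str t : {rmorphism pol -> S}); split=> [c|i].
  by rewrite [LHS]/= mmapC.
by rewrite /= mmapX mmap1U.
Qed.

Lemma mpoly_eval_uniq (R : comPzRingType) (f g : {rmorphism pol -> R}) :
  (forall c, f (mpolyC m c) = g (mpolyC m c)) ->
  (forall i, f (polX i) = g (polX i)) -> f =1 g.
Proof.
move=> fgC fgX; elim/mpolyind=> [|c e p _ _ IH]; first by rewrite !rmorph0.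
rewrite !rmorphD IH -mul_mpolyC !rmorphM fgC mpolyXE_id !rmorph_prod.
congr (_ * _ + _); apply: eq_bigr => i _.
by rewrite !rmorphXn fgX.
Qed.

Definition mpoly_prodX : pol := \prod_i polX i.

(** Laurent polynomials are the fractions whose denominator is a power of the
    product of all variables. Inside the fraction field they visibly form a
    domain. *)
Definition laurent_pred : {pred {fraction pol}} :=
  fun f => `[< exists p k, f * frac mpoly_prodX ^+ k = frac p >].

Lemma laurentP f :
  reflect (exists p k, f * frac mpoly_prodX ^+ k = frac p) (f \in laurent_pred).
Proof. exact: asboolP. Qed.

Lemma laurent_subring_closed : subring_closed laurent_pred.
Proof.
split=> [|f g /laurentP[p [k fp]] /laurentP[q [l gq]]|
          f g /laurentP[p [k fp]] /laurentP[q [l gq]]]; apply/laurentP.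
- by exists 1, 0%N; rewrite expr0 mulr1 rmorph1.
- exists (p * mpoly_prodX ^+ l - q * mpoly_prodX ^+ k), (k + l)%N.
  rewrite rmorphB !rmorphM !rmorphXn /= -fp -gq exprD mulrBl.
  by rewrite mulrA [X in _ - _ * X]mulrC mulrA.
- by exists (p * q), (k + l)%N; rewrite rmorphM /= -fp -gq exprD mulrACA.
Qed.

HB.instance Definition _ :=
  GRing.isSubringClosed.Build {fraction pol} laurent_pred
    laurent_subring_closed.

Record laurent := Laurent {
  laurent_val : {fraction pol};
  laurent_valP : laurent_val \in laurent_pred
}.

HB.instance Definition _ := [isSub for laurent_val].
HB.instance Definition _ := [Choice of laurent by <:].
HB.instance Definition _ := [SubChoice_isSubComNzRing of laurent by <:].

Lemma laurent_of_pol_subproof (p : pol) : frac p \in laurent_pred.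
Proof. by apply/laurentP; exists p, 0%N; rewrite expr0 mulr1. Qed.

Definition laurent_of_pol p := Laurent (laurent_of_pol_subproof p).

Lemma laurent_of_polB : zmod_morphism laurent_of_pol.
Proof. by move=> p q; apply: val_inj; rewrite /= !rmorphB. Qed.
Lemma laurent_of_polM : monoid_morphism laurent_of_pol.
Proof. by split=> [|p q]; apply: val_inj; rewrite /= ?rmorph1 ?rmorphM. Qed.

HB.instance Definition _ :=
  GRing.isZmodMorphism.Build pol laurent laurent_of_pol laurent_of_polB.
HB.instance Definition _ :=
  GRing.isMonoidMorphism.Build pol laurent laurent_of_pol laurent_of_polM.

Definition laurent_alg : comAlg K :=
  @ComAlg K laurent (laurent_of_pol \o @mpolyC m K).

Lemma polX_neq0 i : frac (polX i) != 0.
Proof. by rewrite tofrac_eq0 -msupp_eq0 msuppX. Qed.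

Lemma laurent_Xinv_subproof i : (frac (polX i))^-1 \in laurent_pred.
Proof.
apply/laurentP; exists (\prod_(j | j != i) polX j), 1%N.
by rewrite expr1 /mpoly_prodX (bigD1 i) //= rmorphM mulKf ?polX_neq0.
Qed.

Program Definition laurent_X (i : 'I_m) : ringUnit laurent_alg :=
  @RingUnit laurent_alg (laurent_of_pol (polX i))
    (Laurent (laurent_Xinv_subproof i)) _.
Next Obligation. by move=> i; apply: val_inj; rewrite /= divff ?polX_neq0. Qed.

Lemma laurent_domain : prime_ideal [set 0 : laurent_alg]%classic.
Proof.
split=> /=.
- by [].
- by move=> x y -> ->; rewrite addr0.
- by move=> a x ->; rewrite mulr0.
- by move/eqP; rewrite oner_eq0.
- move=> x y /(congr1 val)/= /eqP; rewrite mulf_eq0 => /orP[]/eqP xy0.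
    by left; apply: val_inj.
  by right; apply: val_inj.
Qed.

(** The value of [f] at a point of the torus is computed from any expression
    of [f] as a quotient by a power of the product of the variables; it does
    not depend on the expression, because that product takes an invertible
    value ([phiP] in the proof). *)
Lemma laurent_universal :
  universal ([ffun i => laurent_X i] : torus K m laurent_alg).
Proof.
move=> R t; have [ev [evC evX]] := mpoly_eval (fun i => unit_val (t i)).
pose T := ev mpoly_prodX; pose U := \prod_i unit_inv (t i).
have TU : T * U = 1.
  rewrite /T /mpoly_prodX rmorph_prod -big_split big1 // => i _.
  by rewrite /= evX unit_valK.
(* Equations in R may be tested after multiplication by powers of T. *)
have T_inj k : injective ( *%R^~ (T ^+ k)).
  move=> a b /= /(congr1 ( *%R^~ (U ^+ k))).
  by rewrite -!mulrA -exprMn TU expr1n !mulr1.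
have frac_ex (f : laurent_alg) : exists pk : pol * nat,
    val f * frac mpoly_prodX ^+ pk.2 = frac pk.1.
  by have /laurentP[p [k fp]] := laurent_valP f; exists (p, k).
have [num numP] := choice frac_ex.
pose phi (f : laurent_alg) : R := ev (num f).1 * U ^+ (num f).2.
have phiT f : phi f * T ^+ (num f).2 = ev (num f).1.
  by rewrite /phi -mulrA -exprMn [U * T]mulrC TU expr1n mulr1.
have phiP (f : laurent_alg) p k :
    val f * frac mpoly_prodX ^+ k = frac p -> phi f * T ^+ k = ev p.
  move=> fp; apply: (T_inj (num f).2).
  rewrite mulrAC phiT -!rmorphXn -!rmorphM /=.
  congr (ev _); apply/eqP; rewrite -tofrac_eq !rmorphM !rmorphXn /=.
  by rewrite -numP -fp mulrAC.
have phiB : zmod_morphism phi.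
  move=> f g; pose k := (num f).2; pose l := (num g).2.
  apply: (T_inj (k + l)%N) => /=.
  rewrite (phiP _
    ((num f).1 * mpoly_prodX ^+ l - (num g).1 * mpoly_prodX ^+ k)).
    rewrite mulrBl exprD mulrA phiT mulrCA phiT.
    by rewrite rmorphB !rmorphM !rmorphXn [X in _ - X]mulrC.
  rewrite !rmorphB !rmorphM !rmorphXn /= -!numP exprD mulrBl -/k -/l.
  by rewrite mulrA; congr (_ - _); rewrite mulrCA mulrC.
have phiM : monoid_morphism phi.
  split=> [|f g].
    by have := @phiP 1 1 0%N; rewrite !expr0 !mulr1 !rmorph1; apply.
  pose k := (num f).2; pose l := (num g).2.
  apply: (T_inj (k + l)%N) => /=; rewrite (phiP _ ((num f).1 * (num g).1)).
    by rewrite exprD mulrACA phiT phiT rmorphM.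
  by rewrite !rmorphM /= -!numP exprD mulrACA.
have phi_pol p : phi (laurent_of_pol p) = ev p.
  by have := @phiP (laurent_of_pol p) p 0%N; rewrite !expr0 !mulr1; apply.
have phiA c : phi (comAlg_str laurent_alg c) = comAlg_str R c.
  by rewrite -evC; exact: phi_pol.
exists (AlgHom phiB phiM phiA); split=> [|psi psi_t].
  apply/ffunP => i; rewrite !ffunE; apply: ringUnit_ext.
  by rewrite /= phi_pol evX.
apply: algHom_ext => f; apply: (T_inj (num f).2) => /=; rewrite phiT.
have psi_pol p : psi (laurent_of_pol p) = ev p.
  apply: (mpoly_eval_uniq (f := psi \o laurent_of_pol) (g := ev)) => [c|i].
    by rewrite evC; exact: (algHomA psi).
  by rewrite evX -psi_t !ffunE.
rewrite /T -!psi_pol -rmorphXn -rmorphM; congr (psi _).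
by apply: val_inj; rewrite rmorphM rmorphXn /= -numP.
Qed.

End LaurentPolynomials.

(** * Monomial transformations *)

Section TorusPermutation.
Variables (K : fieldType) (gT : finGroupType) (k : nat).
Variable to : {action gT &-> 'I_k}.
Local Notation T := (torus K k).
Local Notation C := (constant_scheme K gT).

(** The point [h] permutes the coordinates by [s] on the piece of [s]. *)
Program Definition torus_twist (R : comAlg K) (h : C R) (t : T R) : T R :=
  [ffun i => @RingUnit R (glue h (fun s => unit_val (t (to i s))))
                         (glue h (fun s => unit_inv (t (to i s)))) _].
Next Obligation.
move=> R h t i; rewrite -glueM -[RHS](glue_cst h).
by apply: eq_glue => s; rewrite unit_valK.
Qed.

Program Definition torus_permutation : group_action T C :=
  @Defs.GroupAction K T C torus_twist _ _ _ _.
Next Obligation.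
move=> R S f h t; apply/ffunP => i; rewrite !ffunE; apply: ringUnit_ext.
by rewrite /= glue_map; apply: eq_glue => s; rewrite ffunE.
Qed.
Next Obligation.
move=> R h t u; apply/ffunP => i; rewrite !ffunE; apply: ringUnit_ext.
by rewrite /= -glueM; apply: eq_glue => s; rewrite ffunE.
Qed.
Next Obligation.
move=> R t; apply/ffunP => i; rewrite !ffunE; apply: ringUnit_ext.
by rewrite /= glue1 act1.
Qed.
Next Obligation.
move=> R h l t; apply/ffunP => i; rewrite !ffunE; apply: ringUnit_ext.
rewrite /= glueMg; apply: eq_glue => s; rewrite ffunE /=.
by apply: eq_glue => r; rewrite actM.
Qed.

End TorusPermutation.

Definition perm_torus_act (K : fieldType) (n : nat) :
    group_action (torus K n) (constant_scheme K 'S_n) :=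
  torus_permutation K (perm_action 'I_n).

(** The group of monomial matrices: permutations of the coordinates followed
    by invertible diagonal matrices. *)
Definition monomial_scheme (K : fieldType) (n : nat) : grpFunctor K :=
  semidirect_scheme (perm_torus_act K n).

Lemma perm_neq_ex (T : finType) (s t : {perm T}) :
  s != t -> exists x, s x != t x.
Proof.
move=> st; apply/existsP; apply: contraNT st.
rewrite negb_exists => /forallP st.
by apply/eqP/permP => x; apply/eqP; rewrite -[_ == _]negbK.
Qed.

Section Monomial.
Variables (K : fieldType) (n : nat) (R : comAlg K).
Local Notation vec := {ffun 'I_n -> R}.
Local Notation C := (constant_scheme K 'S_n R).

Definition permute (h : C) (x : vec) : vec :=
  [ffun i => glue h (fun s => x (s i))].

Definition monomial (z : monomial_scheme K n R) (x : vec) : vec :=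
  [ffun i => unit_val (z.1 i) * permute z.2 x i].

Definition vec_delta (i : 'I_n) : vec := [ffun j => (j == i)%:R].

Lemma permute_cst h c : permute h [ffun=> c] = [ffun=> c].
Proof.
apply/ffunP => i; rewrite !ffunE -[RHS](glue_cst h).
by apply: eq_glue => s; rewrite ffunE.
Qed.

Lemma monomial_id : monomial 1%g =1 id.
Proof. by move=> x; apply/ffunP => i; rewrite !ffunE glue1 perm1 mul1r. Qed.

Lemma monomial_mul z w : monomial (z * w)%g =1 monomial z \o monomial w.
Proof.
move=> x; apply/ffunP => i; rewrite !ffunE /= -mulrA; congr (_ * _).
rewrite glueMg -glueM; apply: eq_glue => s; rewrite !ffunE; congr (_ * _).
by apply: eq_glue => t; rewrite permM.
Qed.

Lemma monomial_add z x y : monomial z (x + y) = monomial z x + monomial z y.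
Proof.
apply/ffunP => i; rewrite !ffunE -mulrDr -glueD; congr (_ * _).
by apply: eq_glue => s; rewrite ffunE.
Qed.

Lemma monomial_scale z c x :
  monomial z ([ffun=> c] * x) = [ffun=> c] * monomial z x.
Proof.
apply/ffunP => i; rewrite !ffunE mulrCA -[c in RHS](glue_cst z.2) -glueM.
by congr (_ * _); apply: eq_glue => s; rewrite !ffunE.
Qed.

(** A permutation is recovered from its permutation matrix: [t = s] exactly
    when all the entries of [t] at the places [(i, s i)] are [1]. *)
Lemma const_perm_delta (h : C) (s : 'S_n) :
  h (Defs.fun_delta K s) = \prod_i permute h (vec_delta (s i)) i.
Proof.
have -> : h (Defs.fun_delta K s) = glue h (fun t => \prod_i (t i == s i)%:R).
  rewrite -glue_str; apply: eq_glue => t; rewrite ffunE.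
  have [->|ts] := eqVneq t s.
    by rewrite rmorph1 big1 // => i _; rewrite eqxx.
  have [i tsi] := perm_neq_ex ts.
  by rewrite rmorph0 (bigD1 i) //= (negPf tsi) mul0r.
rewrite glue_prod; apply: eq_bigr => i _; rewrite ffunE.
by apply: eq_glue => t; rewrite ffunE.
Qed.

Lemma monomial_inj z w : monomial z =1 monomial w -> z = w.
Proof.
case: z w => [t h] [u k] tu.
have e : t = u.
  apply/ffunP => i; apply: ringUnit_ext.
  have /ffunP/(_ i) := tu [ffun=> 1].
  by rewrite [LHS]ffunE [RHS]ffunE /= !permute_cst !ffunE !mulr1.
case: _ / e in tu *; congr pair; apply: const_ext => s.
rewrite !const_perm_delta; apply: eq_bigr => i _.
have /ffunP/(_ i) := tu (vec_delta (s i)); rewrite [LHS]ffunE [RHS]ffunE /=.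
move/(congr1 ( *%R (unit_inv (t i)))); rewrite !mulrA.
by rewrite [_ * unit_val _]mulrC unit_valK !mul1r.
Qed.

End Monomial.

(** * Autotopisms of R^n *)

Section Autotopisms.
Variables (K : fieldType) (n : nat) (R : comAlg K).
Local Notation vec := {ffun 'I_n -> R}.
Local Notation delta := (@vec_delta K n R).

(** R-linearity, in the form in which it is used. *)
Definition coordinatewise (F : vec -> vec) :=
  forall x k, F x k = \sum_i x i * F (delta i) k.

(** Expand the product of the row sums: the terms of maps that are not
    injective vanish by orthogonality in the columns. *)
Lemma sum_perm_prod (E : 'I_n -> 'I_n -> R) :
    (forall k, \sum_i E k i = 1) ->
    (forall k l i, k != l -> E k i * E l i = 0) ->
  \sum_(s : 'S_n) \prod_k E k (s k) = 1.
Proof.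
move=> row_sum col_orth.
have : \prod_k \sum_i E k i = 1 by rewrite big1.
rewrite bigA_distr_bigA /=.
rewrite (bigID (fun f : {ffun 'I_n -> 'I_n} => injectiveb f)) /=.
rewrite [X in _ + X]big1 => [|f /injectivePn[k [l kl fkl]]]; last first.
  rewrite (bigD1 k) //= (bigD1 l) 1?eq_sym //= mulrA fkl col_orth //.
  by rewrite mul0r.
rewrite addr0 (reindex (@pval _)) /=; last first.
  pose in_Sn := insubd (1%g : 'S_n).
  by exists in_Sn => /= f Uf; first apply: val_inj; apply: insubdK.
move=> sum1; rewrite -[RHS]sum1; apply: eq_big => [s|s _].
  by rewrite (valP s).
by apply: eq_bigr => k _; rewrite pvalE.
Qed.

(** The matrix [E] of [F] has orthogonal idempotents of sum [1] in each row, as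
    [F] is an algebra morphism. Surjectivity makes the columns orthogonal as
    well: if [F y] is the basis vector of index [k], then multiplication by
    [y i] fixes [E k i] and kills [E l i] for [l != k]. So
    [\prod_k E k (s k)], for [s] a permutation, is a partition of unity, and
    it defines the required point of the constant scheme. *)
Lemma vec_algebra_automorphism (F : vec -> vec) :
    coordinatewise F -> F 1 = 1 -> {morph F : x y / x * y} ->
    (forall y, exists x, F x = y) ->
  exists h : constant_scheme K 'S_n R, F =1 permute h.
Proof.
move=> F_lin F1 FM F_surj; pose E k i := F (delta i) k.
have row_sum k : \sum_i E k i = 1.
  transitivity (F 1 k); last by rewrite F1 ffunE.
  by rewrite [RHS]F_lin; apply: eq_bigr => i _; rewrite ffunE mul1r.
have row_orth k i j : i != j -> E k i * E k j = 0.
  move=> ij; transitivity (F (delta i * delta j) k); first by rewrite FM ffunE.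
  rewrite F_lin big1 // => l _; rewrite !ffunE; case: (eqVneq l i) => [->|_].
    by rewrite (negPf ij) mulr0 mul0r.
  by rewrite !mul0r.
have row_idem k i : E k i * E k i = E k i.
  rewrite -[RHS]mulr1 -(row_sum k) mulr_sumr (bigD1 i) //=.
  rewrite big1 ?addr0 // => j ji.
  by rewrite row_orth // eq_sym.
have col_orth k l i : k != l -> E k i * E l i = 0.
  move=> kl; have [y Fy] := F_surj (delta k).
  have Fy_row j : \sum_i' y i' * E j i' = (j == k)%:R.
    by rewrite -F_lin Fy ffunE.
  have yE j : y i * E j i = (j == k)%:R * E j i.
    rewrite -Fy_row mulr_suml (bigD1 i) //= big1 => [|i' ii'].
      by rewrite addr0 -mulrA row_idem.
    by rewrite -mulrA row_orth ?mulr0.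
  have <- : y i * E k i = E k i by rewrite yE eqxx mul1r.
  by rewrite mulrAC yE eq_sym (negPf kl) !mul0r.
pose d (s : 'S_n) := \prod_k E k (s k).
have sum_d : \sum_s d s = 1 by exact: sum_perm_prod.
have dE k i s : E k i * d s = if s k == i then d s else 0.
  rewrite /d (bigD1 k) //= mulrA; case: (eqVneq (s k) i) => [<-|ski].
    by rewrite row_idem.
  by rewrite row_orth 1?eq_sym // mul0r.
have [|s t st|h hE] := @const_exists K _ R d; first by [].
  have [k stk] := perm_neq_ex st.
  by rewrite {1}/d (bigD1 k) //= mulrAC dE eq_sym (negPf stk) mul0r.
exists h => x; apply/ffunP => k; rewrite F_lin ffunE /glue.
under [RHS]eq_bigr do rewrite hE.
transitivity (\sum_i \sum_s x i * (E k i * d s)).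
  by apply: eq_bigr => i _; rewrite -!mulr_sumr sum_d mulr1.
rewrite exchange_big; apply: eq_bigr => s _; rewrite (bigD1 (s k)) //= big1.
  by rewrite addr0 dE eqxx mulrC.
by move=> i ski; rewrite dE eq_sym (negPf ski) mulr0.
Qed.

(** If [F1 z = 1], then [F3 z] and [F2 z] are the inverses of [F2 1] and
    [F3 1]; the common automorphism is [F2] divided by [F2 1]. *)
Lemma vec_autotopism (F1 F2 F3 : vec -> vec) :
    (forall x y, F1 (x * y) = F2 x * F3 y) -> coordinatewise F2 ->
    (forall y, exists x, F1 x = y) -> (forall y, exists x, F2 x = y) ->
  exists (t u : torus K n R) (h : constant_scheme K 'S_n R),
    [/\ F1 =1 monomial ((t * u)%g, h), F2 =1 monomial (t, h) &
        F3 =1 monomial (u, h)].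
Proof.
move=> F123 F2_lin F1_surj F2_surj; have [z F1z] := F1_surj 1.
pose b := F2 1; pose c := F3 1.
have bK : b * F3 z = 1 by rewrite -F123 mul1r.
have cK : c * F2 z = 1 by rewrite mulrC -F123 mulr1.
have F1E x : F1 x = F2 x * c by rewrite -F123 mulr1.
have F1E' x : F1 x = b * F3 x by rewrite -F123 mul1r.
pose F x := F3 z * F2 x.
have F2E x : F2 x = b * F x by rewrite mulrA bK mul1r.
have F3E x : F3 x = c * F x.
  by rewrite -[LHS]mul1r -bK [b * _]mulrC -mulrA -F1E' F1E mulrA mulrC.
have F_lin : coordinatewise F.
  move=> x k; rewrite ffunE F2_lin mulr_sumr; apply: eq_bigr => i _.
  by rewrite ffunE mulrCA.
have F_1 : F 1 = 1 by rewrite /F mulrC.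
have FM : {morph F : x y / x * y}.
  have bcI : injective ( *%R (b * c)).
    apply: (can_inj (g := *%R (F3 z * F2 z))) => v.
    by rewrite mulrA mulrACA [F3 z * b]mulrC bK mul1r [F2 z * c]mulrC cK mul1r.
  move=> x y; apply: bcI; rewrite mulrAC -F2E -F1E F123 F2E F3E.
  by rewrite mulrACA.
have F_surj y : exists x, F x = y.
  have [x F2x] := F2_surj (b * y); exists x.
  by rewrite /F F2x mulrA [F3 z * b]mulrC bK mul1r.
have [h Fh] := vec_algebra_automorphism F_lin F_1 FM F_surj.
have unit_at (v w : vec) : v * w = 1 -> forall i, v i * w i = 1.
  by move=> vw i; have /ffunP/(_ i) := vw; rewrite !ffunE.
exists [ffun i => RingUnit (unit_at _ _ bK i)].
exists [ffun i => RingUnit (unit_at _ _ cK i)], h.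
split=> x; apply/ffunP => i.
- by rewrite F1E F2E Fh !ffunE /= mulrAC.
- by rewrite F2E Fh !ffunE.
- by rewrite F3E Fh !ffunE.
Qed.

End Autotopisms.

(** * Coordinates on scalar extensions *)

Section Frames.
Variables (K : fieldType) (A : vectType K) (n : nat).

(** The coordinates of a scalar extension refer to [vbasis]; [frame] and its
    inverse [coframe] replace them by the coordinates in a basis [b]. *)
Definition frame (b : n.-tuple A) (R : comAlg K)
    (x : {ffun 'I_n -> R}) : ext A R :=
  \sum_k x k *: ext_in R (tnth b k).

Definition coframe (b : n.-tuple A) (R : comAlg K)
    (y : ext A R) : {ffun 'I_n -> R} :=
  [ffun k => \sum_i y 0 i * comAlg_str R (coord b k (ext_vec i))].

Section OneAlgebra.
Variables (R : comAlg K) (b : n.-tuple A).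
Hypothesis b_basis : basis_of {:A} b.

Lemma ext_in_sum I (r : seq I) (c : I -> K) (a : I -> A) :
  ext_in R (\sum_(i <- r) c i *: a i) =
  \sum_(i <- r) comAlg_str R (c i) *: ext_in R (a i).
Proof. by rewrite raddf_sum; apply: eq_bigr => i _ /=; rewrite ext_inZ. Qed.

Lemma coframe_in a k : coframe b (ext_in R a) k = comAlg_str R (coord b k a).
Proof.
rewrite ffunE [in RHS](ext_vecE a) linear_sum rmorph_sum.
by apply: eq_bigr => i _; rewrite linearZ rmorphM mxE.
Qed.

Lemma coframe_sum I (r : seq I) (c : I -> R) (y : I -> ext A R) k :
  coframe b (\sum_(i <- r) c i *: y i) k =
  \sum_(i <- r) c i * coframe b (y i) k.
Proof.
rewrite ffunE; under eq_bigr do rewrite summxE mulr_suml.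
rewrite exchange_big; apply: eq_bigr => i _; rewrite ffunE mulr_sumr.
by apply: eq_bigr => j _; rewrite mxE mulrA.
Qed.

Lemma frameK : cancel (@frame b R) (@coframe b R).
Proof.
move=> x; apply/ffunP => k; rewrite coframe_sum (bigD1 k) //= big1 => [|l lk].
  rewrite coframe_in (tnth_nth 0) coord_free ?(basis_free b_basis) //.
  by rewrite eqxx rmorph1 mulr1 addr0.
rewrite coframe_in (tnth_nth 0) coord_free ?(basis_free b_basis) //.
by rewrite (negPf lk) rmorph0 mulr0.
Qed.

Lemma frame_add x y : frame b (x + y) = frame b x + frame b y :> ext A R.
Proof.
by rewrite /frame -big_split; apply: eq_bigr => k _; rewrite ffunE scalerDl.
Qed.

Lemma frame_scale c x : frame b ([ffun=> c] * x) = c *: frame b x :> ext A R.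
Proof.
by rewrite /frame scaler_sumr; apply: eq_bigr => k _; rewrite !ffunE scalerA.
Qed.

Lemma coframeK : cancel (@coframe b R) (@frame b R).
Proof.
move=> y; rewrite [RHS]extE /frame.
transitivity (\sum_i y 0 i *:
    \sum_k comAlg_str R (coord b k (ext_vec i)) *: ext_in R (tnth b k)).
  under [RHS]eq_bigr do rewrite scaler_sumr.
  rewrite exchange_big; apply: eq_bigr => k _; rewrite ffunE scaler_suml.
  by apply: eq_bigr => i _; rewrite scalerA.
apply: eq_bigr => i _; congr (_ *: _); rewrite -ext_in_sum; congr (ext_in R _).
have /coord_span {2}-> : ext_vec i \in <<b>>%VS.
  by rewrite (span_basis b_basis) memvf.
by apply: eq_bigr => k _; rewrite (tnth_nth 0).
Qed.

End OneAlgebra.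

Lemma ext_map_frame (R S : comAlg K) (f : algHom R S) b x :
  ext_map f (frame b x) = frame b [ffun k => f (x k)].
Proof.
rewrite /frame ext_map_sum; apply: eq_bigr => k _.
by rewrite ext_mapZ ext_map_in ffunE.
Qed.

Lemma monomial_map (R S : comAlg K) (f : algHom R S)
    (z : monomial_scheme K n R) x :
  [ffun k => f (monomial z x k)] =
  monomial (Defs.fmap (monomial_scheme K n) f z) [ffun k => f (x k)].
Proof.
apply/ffunP => i; rewrite !ffunE rmorphM [X in _ * X](glue_map f) /=.
congr (_ * _).
by apply: eq_glue => s; rewrite ffunE.
Qed.

Section MonomialAutomorphism.
Variables (b : n.-tuple A) (b_basis : basis_of {:A} b) (R : comAlg K).

Definition monomial_fun (z : monomial_scheme K n R) (y : ext A R) : ext A R :=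
  frame b (monomial z (coframe b y)).

Lemma monomial_fun_mul z w :
  monomial_fun (z * w)%g =1 monomial_fun z \o monomial_fun w.
Proof. by move=> y; rewrite /monomial_fun /= frameK // monomial_mul. Qed.

Lemma monomial_fun1 : monomial_fun 1%g =1 id.
Proof. by move=> y; rewrite /monomial_fun monomial_id coframeK. Qed.

Lemma monomial_fun_linear z : linear (monomial_fun z).
Proof.
move=> c x y; rewrite /monomial_fun.
have -> : coframe b (c *: x + y) = [ffun=> c] * coframe b x + coframe b y.
  apply: (can_inj (frameK b_basis)).
  by rewrite frame_add frame_scale !coframeK.
by rewrite monomial_add monomial_scale frame_add frame_scale.
Qed.

(** Invertibility comes for free from the group law of the monomial scheme. *)
Lemma monomial_fun_bij z : bijective (monomial_fun z).
Proof.
exists (monomial_fun z^-1%g) => y.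
  by have := monomial_fun_mul z^-1%g z y; rewrite mulVg monomial_fun1.
by have := monomial_fun_mul z z^-1%g y; rewrite mulgV monomial_fun1.
Qed.

Definition monomial_aut z : linAut (ext A R) :=
  LinAut (monomial_fun_linear z) (monomial_fun_bij z).

Lemma monomial_autM : {morph monomial_aut : z w / (z * w)%g}.
Proof. by move=> z w; apply: linAut_ext; exact: monomial_fun_mul. Qed.

Lemma monomial_aut_inj : injective monomial_aut.
Proof.
move=> z w zw; apply: monomial_inj => x.
have := congr1 (fun f : linAut (ext A R) => coframe b (f (frame b x))) zw.
by rewrite /= /monomial_fun !frameK.
Qed.

Lemma eq_monomial_aut z (f : linAut (ext A R)) :
  (forall x, coframe b (f (frame b x)) = monomial z x) -> f = monomial_aut z.
Proof.
move=> fz; apply: linAut_ext => y.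
by rewrite /= /monomial_fun -fz !coframeK.
Qed.

End MonomialAutomorphism.

Lemma base_change_monomial_aut (b : n.-tuple A)
    (b_basis : basis_of {:A} b) (R S : comAlg K) (f : algHom R S)
    (z : monomial_scheme K n R) :
  base_change f (monomial_aut b_basis z) =
  monomial_aut b_basis (Defs.fmap (monomial_scheme K n) f z).
Proof.
apply: linAut_ext; apply: (base_change_uniq (f := f)) => x.
rewrite [LHS](base_change_fun_map f (monomial_aut b_basis z)) /= /monomial_fun.
rewrite ext_map_frame monomial_map -{2}(coframeK b_basis x).
by rewrite ext_map_frame frameK.
Qed.

End Frames.

(** * Ternary automorphisms of a perfect evolution algebra *)

Section BlockAction.
Variables r n : nat.

(** The inverse of [mxvec_index]: a torus of dimension [r * n] is viewed as
    [r] blocks of [n] coordinates each. *)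
Definition block_coord (j : 'I_(r * n)) : 'I_r * 'I_n :=
  enum_val (cast_ord (esym (mxvec_cast r n)) j).

Lemma block_coordK a k : block_coord (mxvec_index a k) = (a, k).
Proof. by rewrite /block_coord /mxvec_index cast_ordK enum_rankK. Qed.

Definition block_perm (j : 'I_(r * n)) (s : 'S_n) : 'I_(r * n) :=
  mxvec_index (block_coord j).1 (s (block_coord j).2).

Lemma block_perm1 : block_perm^~ 1%g =1 id.
Proof.
move=> j; case/mxvec_indexP: j => a k.
by rewrite /block_perm block_coordK perm1.
Qed.

Lemma block_permM j : act_morph block_perm j.
Proof. by move=> s t; rewrite /block_perm block_coordK permM. Qed.

Definition block_action : {action 'S_n &-> 'I_(r * n)} :=
  TotalAction block_perm1 block_permM.

Variable K : fieldType.

Definition block_torus_act :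
    group_action (torus K (r * n)) (constant_scheme K 'S_n) :=
  torus_permutation K block_action.

Definition block (a : 'I_r) (R : comAlg K)
    (t : torus K (r * n) R) : torus K n R :=
  [ffun k => t (mxvec_index a k)].

Lemma blockM a (R : comAlg K) : {morph block a (R := R) : t u / (t * u)%g}.
Proof. by move=> t u; apply/ffunP => k; rewrite !ffunE. Qed.

Lemma block_act a (R : comAlg K) h t :
  block a (Defs.gact block_torus_act h t) =
  Defs.gact (perm_torus_act K n) h (block a t) :> torus K n R.
Proof.
apply/ffunP => k; rewrite !ffunE; apply: ringUnit_ext.
by apply: eq_glue => s; rewrite /= /block_perm block_coordK ffunE.
Qed.

End BlockAction.

Section TautOfEvolutionAlgebra.
Variables (K : fieldType) (A : vectType K) (mu : {bilinear A -> A -> A}).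
Variable n : nat.
Variable e : n.-tuple A.
Hypotheses (e_natural : natural_basis mu e) (A_perfect : perfect mu).

Definition squares : n.-tuple A := [tuple mu (tnth e k) (tnth e k) | k < n].

Lemma natural_basis_of : basis_of {:A} e. Proof. exact: e_natural.1. Qed.

Lemma mu_coord x y :
  mu x y = \sum_k (coord e k x * coord e k y) *: tnth squares k.
Proof.
have expand z : z = \sum_k coord e k z *: tnth e k.
  have /coord_span {1}-> : z \in <<e>>%VS.
    by rewrite (span_basis natural_basis_of) memvf.
  by apply: eq_bigr => k _; rewrite (tnth_nth 0).
rewrite {1}(expand x) linear_sumlz; apply: eq_bigr => i _.
rewrite {1}(expand y) linear_sumr (bigD1 i) //= big1 => [|j ji].
  by rewrite addr0 linearZl_LR linearZr_LR scalerA tnth_mktuple.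
by rewrite linearZl_LR linearZr_LR e_natural.2 ?scaler0 // eq_sym.
Qed.

(** Products of basis vectors vanish off the diagonal, so the squares span the
    image of the product, which is all of [A]; there are as many of them as
    the dimension. *)
Lemma squares_basis : basis_of {:A} squares.
Proof.
rewrite basisEdim size_tuple (vector.size_basis natural_basis_of) leqnn andbT.
apply/subvP => a _; have [s ->] := A_perfect a.
apply: memv_suml => p _; apply: memvZ; rewrite mu_coord.
by apply: memv_suml => k _; apply: memvZ; apply: memv_span; exact: mem_tnth.
Qed.

Section Points.
Variable R : comAlg K.

Lemma ext_mul_suml I (r : seq I) (c : I -> R) (x : I -> ext A R) y :
  ext_mul mu (\sum_(i <- r) c i *: x i) y =
  \sum_(i <- r) c i *: ext_mul mu (x i) y.
Proof.
pose f : {linear ext A R -> ext A R} := HB.pack (fun x => ext_mul mu x y)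
  (GRing.isLinear.Build R (ext A R) (ext A R) *:%R _ (ext_mul_linl mu y)).
rewrite -[LHS]/(f _) linear_sum; apply: eq_bigr => i _.
by rewrite linearZ.
Qed.

Lemma ext_mul_sumr I (r : seq I) (c : I -> R) (y : I -> ext A R) x :
  ext_mul mu x (\sum_(i <- r) c i *: y i) =
  \sum_(i <- r) c i *: ext_mul mu x (y i).
Proof.
pose f : {linear ext A R -> ext A R} := HB.pack (ext_mul mu x)
  (GRing.isLinear.Build R (ext A R) (ext A R) *:%R _ (ext_mul_linr mu x)).
rewrite -[LHS]/(f _) linear_sum; apply: eq_bigr => i _.
by rewrite linearZ.
Qed.

(** The algebra is isotopic to [R^n]: only the basis used for the value of the
    product differs from the one used for its arguments. *)
Lemma ext_mul_frame (x y : {ffun 'I_n -> R}) :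
  ext_mul mu (frame e x) (frame e y) = frame squares (x * y).
Proof.
rewrite /frame ext_mul_suml; apply: eq_bigr => i _.
rewrite ext_mul_sumr (bigD1 i) //= big1 => [|j ji].
  by rewrite addr0 scalerA ext_mul_in tnth_mktuple ffunE.
by rewrite ext_mul_in e_natural.2 1?eq_sym // raddf0 scaler0.
Qed.

Local Notation SD := (semidirect_scheme (block_torus_act 2 n K)).

(** The two blocks of torus coordinates act through [taut2] and [taut3], and
    their product through [taut1]. *)
Definition factor (a : 'I_2) (z : SD R) : monomial_scheme K n R :=
  (block a z.1, z.2).
Definition product_factor (z : SD R) : monomial_scheme K n R :=
  ((block ord0 z.1 * block ord_max z.1)%g, z.2).

Lemma factorM a : {morph factor a : z w / (z * w)%g}.
Proof. by move=> z w; congr pair; rewrite /= blockM block_act. Qed.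

Lemma torus_mulC (k : nat) : commutative (fun t u : torus K k R => (t * u)%g).
Proof.
move=> t u; apply/ffunP => i; rewrite !ffunE; apply: ringUnit_ext.
by rewrite /= mulrC.
Qed.

(** The product of two equivariant homomorphisms to the torus is again one,
    because the torus is commutative. *)
Lemma product_factorM : {morph product_factor : z w / (z * w)%g}.
Proof.
move=> z w; congr pair.
pose act t : torus K n R := Defs.gact (perm_torus_act K n) z.2 t.
transitivity ((block ord0 z.1 * act (block ord0 w.1)) *
              (block ord_max z.1 * act (block ord_max w.1)))%g.
  by rewrite /act -!block_act -!blockM.
transitivity ((block ord0 z.1 * block ord_max z.1) *
              act (block ord0 w.1 * block ord_max w.1))%g.
  rewrite /act Defs.gactM -!mulgA; congr (_ * _)%g; rewrite !mulgA.
  by congr (_ * _)%g; exact: torus_mulC.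
by [].
Qed.

Lemma monomial_product_factor z x y :
  monomial (product_factor z) (x * y) =
  monomial (factor ord0 z) x * monomial (factor ord_max z) y.
Proof.
apply/ffunP => i; rewrite !ffunE /= mulrACA -glueM; congr (_ * _).
by apply: eq_glue => s; rewrite ffunE.
Qed.

Lemma taut_of_subproof (z : SD R) (x y : ext A R) :
  monomial_aut squares_basis (product_factor z) (ext_mul mu x y) =
  ext_mul mu (monomial_aut natural_basis_of (factor ord0 z) x)
    (monomial_aut natural_basis_of (factor ord_max z) y).
Proof.
rewrite /= /monomial_fun ext_mul_frame -monomial_product_factor.
rewrite -{1}(coframeK natural_basis_of x) -{1}(coframeK natural_basis_of y).
rewrite ext_mul_frame frameK //.
exact: squares_basis.
Qed.

Definition taut_of (z : SD R) : Taut mu R := TautPoint (taut_of_subproof z).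

Lemma taut_of_mul : {morph taut_of : z w / (z * w)%g}.
Proof.
by move=> z w; apply: tautPoint_ext;
  rewrite /= ?product_factorM ?factorM monomial_autM.
Qed.

Lemma taut_of_inj : injective taut_of.
Proof.
move=> z w zw.
have /monomial_aut_inj zw0 := congr1 (@taut2 _ _ _ _) zw.
have /monomial_aut_inj zw1 := congr1 (@taut3 _ _ _ _) zw.
have [t0 h0] := (congr1 fst zw0, congr1 snd zw0).
have t1 := congr1 fst zw1; rewrite /= in t0 t1 h0.
case: z w {zw zw0 zw1} t0 t1 h0 => [t h] [u k] /= t0 t1 ->; congr pair.
apply/ffunP => j; case/mxvec_indexP: j => a i.
have /ffunP/(_ i) := t0; have /ffunP/(_ i) := t1; rewrite !ffunE.
have [->|a0] := eqVneq a ord0; first by [].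
by rewrite (_ : a = ord_max) //; apply: val_inj; case: a a0 => [[|[]]].
Qed.

(** In the two bases, [g] becomes an autotopism of [R^n]. *)
Lemma taut_of_surj (g : Taut mu R) : exists z, taut_of z = g.
Proof.
have F_surj (b : n.-tuple A) (f : linAut (ext A R)) y : basis_of {:A} b ->
    exists x, coframe b (f (frame b x)) = y.
  move=> b_basis; exists (coframe b (linAut_inv f (frame b y))).
  by rewrite coframeK // linAut_Kinv frameK.
have [|x k|y|y|t [u [h [F1E F2E F3E]]]] := @vec_autotopism K n R
    (fun x => coframe squares (taut1 g (frame squares x)))
    (fun x => coframe e (taut2 g (frame e x)))
    (fun x => coframe e (taut3 g (frame e x))).
- move=> x y; apply: (can_inj (frameK squares_basis)).
  rewrite coframeK ?squares_basis // -ext_mul_frame tautP.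
  by rewrite -ext_mul_frame !coframeK ?natural_basis_of.
- rewrite {1}/frame linear_sum.
  under eq_bigr do rewrite linearZ.
  rewrite coframe_sum; apply: eq_bigr => i _.
  have -> : frame e (vec_delta R i) = ext_in R (tnth e i) :> ext A R.
    rewrite /frame (bigD1 i) //= big1 => [|j ji]; rewrite ffunE.
      by rewrite eqxx scale1r addr0.
    by rewrite (negPf ji) scale0r.
  by [].
- exact: F_surj squares_basis.
- exact: F_surj natural_basis_of.
pose T : torus K (2 * n) R := [ffun j =>
  if (block_coord j).1 == ord0 then t (block_coord j).2
  else u (block_coord j).2].
have T0 : block ord0 T = t.
  by apply/ffunP => k; rewrite !ffunE block_coordK eqxx.
have T1 : block ord_max T = u.
  by apply/ffunP => k; rewrite !ffunE block_coordK.
exists (T, h); apply: tautPoint_ext; symmetry; apply: eq_monomial_aut => x.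
- by rewrite /product_factor T0 T1 F1E.
- by rewrite /factor T0 F2E.
- by rewrite /factor T1 F3E.
Qed.

End Points.

Lemma taut_of_natural : natural taut_of.
Proof.
move=> R S f z; apply: tautPoint_ext; rewrite /= base_change_monomial_aut;
  congr (monomial_aut _ (_, _)); apply/ffunP => k; rewrite !ffunE //=.
by apply: ringUnit_ext; rewrite /= rmorphM.
Qed.

Lemma Taut_semidirect :
  group_isomorphic (Taut mu) (semidirect_scheme (block_torus_act 2 n K)).
Proof.
apply: group_isomorphic_sym; exists taut_of; split.
  by split; [exact: taut_of_natural|exact: taut_of_mul].
move=> R; have [g gP] := choice (@taut_of_surj R).
by exists g => [z|//]; exact: taut_of_inj.
Qed.

End TautOfEvolutionAlgebra.

(** * The structure theorem *)

Lemma scheme_isomorphic_semidirect (K : fieldType) (G N H : grpFunctor K)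
    (act : group_action N H) :
  group_isomorphic G (semidirect_scheme act) ->
  scheme_isomorphic G (product_scheme N H).
Proof.
move=> [alpha [[alpha_nat _] alpha_bij]].
by exists alpha; split=> [R S f x|R]; [exact: alpha_nat|exact: alpha_bij].
Qed.

Theorem theorem3p7 (K : fieldType) (n : nat) (n_ge1 : (1 <= n)%N)
    (A : vectType K) (mu : {bilinear A -> A -> A})
    (A_evolution : evolution_algebra mu n) (A_perfect : perfect mu) :
  [/\ affine (Taut mu),
      forall rep : representation (Taut mu),
        identity_component_isomorphic rep (torus K (2 * n)%N),
      scheme_isomorphic (Taut mu)
        (product_scheme (torus K (2 * n)%N) (constant_scheme K 'S_n)) &
      exists act : group_action (torus K (2 * n)%N) (constant_scheme K 'S_n),
        group_isomorphic (Taut mu) (semidirect_scheme act)].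
Proof.
have [e e_natural] := A_evolution.
have semidirect := Taut_semidirect e_natural A_perfect.
have product := scheme_isomorphic_semidirect semidirect.
split=> [|rep|//|]; last by exists (block_torus_act 2 n K).
  have [alpha [alpha_nat alpha_bij]] := product.
  have [beta [beta_nat alphaK betaK]] := natural_inverse alpha_bij alpha_nat.
  have univ := universal_iso beta_nat (fun R => Bijective (betaK R) (alphaK R))
    (universal_product_constant (gT := 'S_n) (@laurent_universal K (2 * n))).
  by exists (Representation univ).
apply: identity_component_semidirect semidirect.
  exact: laurent_universal.
exact: laurent_domain.
Qed.
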